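(* (Stability of minimizers in the presence of noise.) Use the notation of the context. Assume that $\overline{B(R/3)}\cap H^\delta\ne\varnothing$. Let $q^*$ be the exact solution with noiseless data, i.e. $F(q^* )=0$ in $\Omega_T$ and $q^*\in H^*$, and suppose that $q^*\in B(R/3)\cap H^*$. Suppose that there exist functions $G^\delta\in H^5(\Omega_T)\cap H^\delta$ and $G^*\in H^5(\Omega_T)\cap H^*$ with $[G^\delta-G^*]<\delta$. Let $c^*(x)=\frac{1}{16(q^*(x,0))^4}\le\overline c$, $x\in[\epsilon,M]$, be the exact target coefficient. Let $\alpha\in(0,2\sqrt{\overline c})$ and let $\lambda_1=\lambda_1(R,T,\epsilon,\underline c,\overline c,\alpha,M)$ be the convexity threshold described in the context. Let $\lambda\ge\lambda_1$ and $\beta=2e^{-\lambda\alpha T}$. Let $q^\delta_{\min}$ be the minimizer of $J_{\lambda,\alpha,\beta}$ on $\overline{B(R)}\cap H^\delta$, and let $c^\delta_{\min}(x)=\frac{1}{16(q^\delta_{\min}(x,0))^4}$, $x\in[\epsilon,M]$. Assume that $$\alpha T>2M.$$ Choose a number $T_0\in(0,T)$ such that $$\alpha T>2M+2\alpha T_0,$$ which is possible since $\alpha T>2M$. Choose the number $\delta_0=\delta_0(R,T,\epsilon,\underline c,\overline c,\alpha,M)>0$, depending only on the listed parameters, so small that $$\delta_0<2R/3,\qquad \ln\big(\delta_0^{-2/(\alpha T)}\big)\ge\lambda_1(R,T,\epsilon,\underline c,\overline c,\alpha,M).$$ Let $\delta\in(0,\delta_0)$. Introduce two numbers $$\rho_1=\frac{\alpha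 T-2(M+\alpha T_0)}{\alpha T},\qquad \rho_2=\frac{\alpha T-2M}{\alpha T};\qquad \rho_1,\rho_2\in(0,1).$$ Then the following stability estimates are valid for all $\delta\in(0,\delta_0)$: $$\|q^*-q^\delta_{\min}\|_{H^1(\Omega_{T_0})}\le C\delta^{\rho_1},$$ $$\|q^*(x,0)-q^\delta_{\min}(x,0)\|_{H^1(\epsilon,M)}\le C\delta^{\rho_2},$$ $$\|c^*-c^\delta_{\min}\|_{H^1(\epsilon,M)}\le C\delta^{\rho_2},$$ where the constant $C=C(R,T,\epsilon,\underline c,\overline c,\alpha,M)>0$ depends only on the listed parameters.
   Context: Let $0<\epsilon\ll1<M<\infty$, $T>0$, let $R>0$ be arbitrary, and $0<\underline c<\overline c<\infty$, where $\underline c,\overline c$ are known lower and upper bounds on $[\epsilon,M]$ of the unknown coefficient $c\in C^3(\mathbb R)$, which equals $1$ outside $[\epsilon,M]$. $\Omega_T=(\epsilon,M)\times(0,T)$, $\Omega_{T_0}=(\epsilon,M)\times(0,T_0)$. $[\cdot,\cdot]$ and $[\cdot]$ denote the scalar product and norm of the real Sobolev space $H^5(\Omega_T)$; $B(r)=\{q\in H^5(\Omega_T):[q]<r\}$. Put $\underline q=1/(2\overline c^{1/4})$. For a pair of data functions $(g_0,g_1)$ on $[0,T+\epsilon]$ consider the set $$\Big\{q\in H^5(\Omega_T):\ q(\epsilon,t)=g_0(t+\epsilon),\ q_x(\epsilon,t)=g_1(t+\epsilon)+g_0'(t+\epsilon),\ q_x(M,t)=0\ \ \forall t\in[0,T];\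 \ q(x,0)\ge\underline q\ \ \forall x\in[\epsilon,M]\Big\}.$$ It is denoted $H^*$ when $(g_0,g_1)=(g_0^*,g_1^* )$ is the ideal noiseless data, and $H^\delta$ when $(g_0,g_1)=(g_0^\delta,g_1^\delta)$ is the noisy data, where the sufficiently small number $\delta>0$ is the noise level. (Here $g_0(t)$ and $g_1(t)$ represent $u(\epsilon,t)$ and $u_x(\epsilon,t)$, where $c(x)u_{tt}=u_{xx}$ on $\mathbb R\times(0,\infty)$, $u(x,0)=0$, $u_t(x,0)=\delta_0(x)$, the last being the Dirac function.) Define $$F(q)(x,t)=q_{xx}(x,t)-\frac{q_{xt}(x,t)}{2q^2(x,0)}+\frac{q_t(x,t)\,q_x(x,0)}{2q^3(x,0)},\qquad J_{\lambda,\alpha,\beta}(q)=\int_{\Omega_T}e^{-2\lambda(x+\alpha t)}|F(q)|^2\,dxdt+\beta[q]^2 .$$ $H_0=\{h\in H^5(\Omega_T):h(\epsilon,t)=h_x(\epsilon,t)=h_x(M,t)=0\ \forall t\in[0,T]\}$, and $J'_{\lambda,\alpha,\beta}(q)\in H_0$ is the Fréchet derivative: $J_{\lambda,\alpha,\beta}(q+h)-J_{\lambda,\alpha,\beta}(q)=[J'_{\lambda,\alpha,\beta}(q),h]+o([h])$ as $[h]\to0$ with $q+h$ in the same set; $J'_{\lambda,\alpha,\beta}(q)(h)=[J'_{\lambda,\alpha,\beta}(q),h]$. Convexity threshold (the paper's convexification theorem, with $H^\delta$ as the admissible set): for $\alpha\in(0,2\sqrt{\overline c})$, $\lambda_1=\lambda_1(R,T,\epsilon,\underline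 c,\overline c,\alpha,M)\ge\lambda_0$ is a constant depending only on the listed parameters such that for all $\lambda\ge\lambda_1$, $\beta\in[2e^{-\lambda\alpha T},1)$ and all $q,q+h\in\overline{B(R)}\cap H^\delta$, $$J_{\lambda,\alpha,\beta}(q+h)-J_{\lambda,\alpha,\beta}(q)-J'_{\lambda,\alpha,\beta}(q)(h)\ge C\int_{\Omega_T}e^{-2\lambda(x+\alpha t)}\big[|h_x|^2+|h_t|^2+|h|^2\big]dxdt+C\int_\epsilon^M e^{-2\lambda x}\big(|h_x(x,0)|^2+|h(x,0)|^2\big)dx+\frac\beta2[h]^2$$ with $C=C(R,T,\epsilon,\underline c,\overline c,\alpha,M)>0$, and $J_{\lambda,\alpha,\beta}$ has a unique minimizer on $\overline{B(R)}\cap H^\delta$. Here $\lambda_0\ge1$ is the threshold of the following Carleman estimate: let $m\in C^1([\epsilon,M])$ with $0<m_0<m(x)<m_1$, $m_2=\max_{[\epsilon,M]}|m'|$, $L_0v=v_{xx}-m(x)v_{xt}$, $g\in C^1(\overline{\Omega_T})$. There exist $\alpha_0>0$ and a sufficiently large $\lambda_0\ge1$, both depending only on $m_0,m_1,m_2,\epsilon,M,\|g\|_{C^1(\overline{\Omega_T})},T$, such that for all $\alpha\in(0,\alpha_0)$, $\lambda\ge\lambda_0$, $v\in H^2(\Omega_T)$ $$ \begin{aligned} &\int_{\Omega_T}e^{-2\lambda(x+\alpha t)}|L_0v|^2dxdt+\int_{\Omega_T}e^{-2\lambda(x+\alpha t)}g\,v_{xt}(x,t)v(x,0)\,dxdt\\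 &\ge C\lambda\int_{\Omega_T}e^{-2\lambda(x+\alpha t)}\big(|v_x|^2+|v_t|^2+\lambda^2|v|^2\big)dtdx-C\lambda\int_0^Te^{-2\lambda(\epsilon+\alpha t)}\big(|v_x(\epsilon,t)|^2+\lambda^2|v(\epsilon,t)|^2+|v_t(\epsilon,t)|^2\big)dt\\ &\quad+C\lambda\int_\epsilon^Me^{-2\lambda x}\big(|v_x(x,0)|^2+\lambda^2|v(x,0)|^2\big)dx-C\lambda\int_\epsilon^Me^{-2\lambda(x+\alpha T)}\big(|v_x(x,T)|^2+\lambda^2|v(x,T)|^2\big)dx, \end{aligned} $$ with $C>0$ depending only on $m_0,m_1,m_2,\epsilon,M,\|g\|_{C^1(\overline{\Omega_T})}$; it is used with $m(x)=1/(2q^2(x,0))$ and $g=2F(q)/q^3(x,0)$.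
   Formalization: The parameter λ is taken to be ln(δ^{-2/(αT)}) (for λ chosen independently of δ the estimates fail), and the upper bound c̄ is required to be strictly greater than 1 (for c̄ = 1 the constraint q(x,0) ≥ q̲ is active at x = ε and the estimates fail). *)

(* Defs.v *)
From HB Require Import structures.
From mathcomp Require Export all_boot all_order all_algebra.
From mathcomp Require Export all_classical all_reals all_analysis.

Set Implicit Arguments.
Unset Strict Implicit.
Unset Printing Implicit Defensive.

Import Order.TTheory GRing.Theory Num.Theory.
Import numFieldNormedType.Exports.

Local Open Scope classical_set_scope.
Local Open Scope ring_scope.

(* Points of the plane are written (x, t). *)

Definition leb2 (R : realType) :=
  (@lebesgue_measure R \x @lebesgue_measure R)%E.

Arguments leb2 R : clear implicits.

Definition Omega (R : realType) (eps M T : R) : set (R * R) :=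
  [set p | eps < p.1 < M /\ 0 < p.2 < T].

Definition cOmega (R : realType) (eps M T : R) : set (R * R) :=
  [set p | eps <= p.1 <= M /\ 0 <= p.2 <= T].

(* ------------------------------------------------------------------------ *)
(* Sobolev spaces on open subsets of the plane                              *)
(* ------------------------------------------------------------------------ *)

Definition pdx (R : realType) (f : R * R -> R) : R * R -> R :=
  fun p => derive1 (fun x : R => f (x, p.2)) p.1.

Definition pdt (R : realType) (f : R * R -> R) : R * R -> R :=
  fun p => derive1 (fun t : R => f (p.1, t)) p.2.

Definition pd (R : realType) (i j : nat) (f : R * R -> R) : R * R -> R :=
  iter i (@pdx R) (iter j (@pdt R) f).

Definition smooth (R : realType) (f : R * R -> R) : Prop :=
  forall i j : nat,
    continuous (pd i j f) /\
    forall p : R * R,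
      derivable (fun x : R => pd i j f (x, p.2)) p.1 1 /\
      derivable (fun t : R => pd i j f (p.1, t)) p.2 1.

Definition test_function (R : realType) (U : set (R * R)) (f : R * R -> R) :
    Prop :=
  smooth f /\
  exists K : set (R * R),
    [/\ compact K, K `<=` U & forall p, ~ K p -> f p = 0].

Definition square_integrable (R : realType) (U : set (R * R))
    (f : R * R -> R) : Prop :=
  measurable_fun U f /\
  (\int[leb2 R]_(p in U) ((f p ^+ 2)%:E) < +oo)%E.

(* w is the weak derivative of f in U, of order i in x and j in t. *)
Definition weak_derivative (R : realType) (U : set (R * R)) (i j : nat)
    (f w : R * R -> R) : Prop :=
  forall phi : R * R -> R, test_function U phi ->
    \int[leb2 R]_(p in U) (f p * pd i j phi p) =
    (-1) ^+ (i + j) * \int[leb2 R]_(p in U) (w p * phi p).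

(* An element of a Sobolev space is carried together with its derivatives:   *)
(* q i j stands for the derivative of order i in x and j in t, so that       *)
(* q 0 0 is the function itself and q 1 0, q 1 1, q 2 0, ... are             *)
(* q_x, q_xt, q_xx, ...  Jets are added and subtracted pointwise.            *)
Definition jet (R : realType) : Type := nat -> nat -> R * R -> R.

(* Scalar product and norm of H^k(U). *)
Definition sob_dot (R : realType) (k : nat) (U : set (R * R))
    (q h : jet R) : R :=
  \sum_(i < k.+1) \sum_(j < k.+1 | (i + j <= k)%N)
    \int[leb2 R]_(p in U) (q i j p * h i j p).

Definition sob_norm (R : realType) (k : nat) (U : set (R * R))
    (q : jet R) : R :=
  Num.sqrt (sob_dot k U q q).

(* H^5 of the rectangle.  The first clause is membership in H^5: all weak    *)
(* derivatives up to order 5 exist and are square integrable.  The other two *)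
(* fix the representative: H^5 of a rectangle embeds into C^3 of its         *)
(* closure, so the derivatives of order at most 3 are taken continuous up to *)
(* the boundary, and hence classical inside.  This is what gives a meaning   *)
(* to the values q(x,0), q(eps,t), q_x(eps,t), q_x(M,t).                     *)
Definition H5 (R : realType) (eps M T : R) (q : jet R) : Prop :=
  [/\ forall i j : nat, (i + j <= 5)%N ->
        square_integrable (Omega eps M T) (q i j) /\
        weak_derivative (Omega eps M T) i j (q 0%N 0%N) (q i j),
      forall i j : nat, (i + j <= 3)%N ->
        {within cOmega eps M T, continuous (q i j)}
    & forall i j : nat, (i + j <= 2)%N ->
        forall p : R * R, Omega eps M T p ->
          is_derive p.1 1 (fun x : R => q i j (x, p.2)) (q i.+1 j p) /\
          is_derive p.2 1 (fun t : R => q i j (p.1, t)) (q i j.+1 p)].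

(* The bracket [q, h] and the norm [q] of H^5(Omega_T). *)
Definition dot5 (R : realType) (eps M T : R) (q h : jet R) : R :=
  sob_dot 5 (Omega eps M T) q h.

Definition norm5 (R : realType) (eps M T : R) (q : jet R) : R :=
  sob_norm 5 (Omega eps M T) q.

Definition H0 (R : realType) (eps M T : R) (h : jet R) : Prop :=
  H5 eps M T h /\
  forall t : R, 0 <= t <= T ->
    [/\ h 0%N 0%N (eps, t) = 0, h 1%N 0%N (eps, t) = 0
      & h 1%N 0%N (M, t) = 0].

(* Norm of H^1(a, b), for f continuously differentiable on ]a, b[: the weak  *)
(* derivative is then the classical one.                                     *)
Definition H1_norm (R : realType) (a b : R) (f : R -> R) : R :=
  Num.sqrt (\int[@lebesgue_measure R]_(x in `]a, b[)
              (f x ^+ 2 + derive1 f x ^+ 2)).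

(* ------------------------------------------------------------------------ *)
(* Data, admissible sets, coefficient                                       *)
(* ------------------------------------------------------------------------ *)

(* d is the derivative at s of the restriction of g to [a, b] (one-sided at  *)
(* the end points). *)
Definition deriv_on (R : realType) (a b : R) (g : R -> R) (s d : R) : Prop :=
  ((g y - g s) / (y - s)) @[y --> within `[a, b] (s^')] --> d.

Definition qlow (R : realType) (cup : R) : R := (2 * cup `^ 4^-1)^-1.

(* The set H^* or H^delta of the data (g0, g1).  Only the values of g0 on    *)
(* [eps, T + eps] enter: u(eps, t) jumps at t = eps, so the derivative of g0 *)
(* at eps has to be taken from the right.                                    *)
Definition admissible (R : realType) (T eps M cup : R) (g0 g1 : R -> R)
    (q : jet R) : Prop :=
  [/\ H5 eps M T q,
      forall t : R, 0 <= t <= T ->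
        [/\ q 0%N 0%N (eps, t) = g0 (t + eps),
            exists dg0 : R, deriv_on eps (T + eps) g0 (t + eps) dg0 /\
                            q 1%N 0%N (eps, t) = g1 (t + eps) + dg0
          & q 1%N 0%N (M, t) = 0]
    & forall x : R, eps <= x <= M -> qlow cup <= q 0%N 0%N (x, 0)].

(* The intersection of the closed ball of radius r with the set above. *)
Definition ball_admissible (R : realType) (r T eps M cup : R)
    (g0 g1 : R -> R) : set (jet R) :=
  [set q | admissible T eps M cup g0 g1 q /\ norm5 eps M T q <= r].

Definition coefficient (R : realType) (eps M clow cup : R) (c : R -> R) :
    Prop :=
  [/\ forall k : nat, (k < 3)%N -> forall x : R, derivable (derive1n k c) x 1,
      continuous (derive1n 3 c),
      forall x : R, ~ (eps <= x <= M) -> c x = 1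
    & forall x : R, eps <= x <= M -> clow <= c x <= cup].

Definition coef_of (R : realType) (q : jet R) : R -> R :=
  fun x => (16 * q 0%N 0%N (x, 0) ^+ 4)^-1.

(* ------------------------------------------------------------------------ *)
(* The functional and its convexity threshold                               *)
(* ------------------------------------------------------------------------ *)

Definition Fop (R : realType) (q : jet R) : R * R -> R :=
  fun p => q 2%N 0%N p
           - q 1%N 1%N p / (2 * q 0%N 0%N (p.1, 0) ^+ 2)
           + q 0%N 1%N p * q 1%N 0%N (p.1, 0) / (2 * q 0%N 0%N (p.1, 0) ^+ 3).

Definition Jfun (R : realType) (T eps M lam alpha beta : R) (q : jet R) : R :=
  \int[leb2 R]_(p in Omega eps M T)
     (expR (- (2 * lam * (p.1 + alpha * p.2))) * Fop q p ^+ 2)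
  + beta * norm5 eps M T q ^+ 2.

(* d is the Frechet derivative of J at q, along increments staying in A. *)
Definition frechet_gradient (R : realType) (T eps M : R) (A : set (jet R))
    (J : jet R -> R) (q d : jet R) : Prop :=
  H0 eps M T d /\
  forall e : R, 0 < e -> exists2 r : R, 0 < r &
    forall h : jet R, A (q + h) -> norm5 eps M T h < r ->
      `| J (q + h) - J q - dot5 eps M T d h | <= e * norm5 eps M T h.

Definition minimizer (R : realType) (A : set (jet R)) (J : jet R -> R)
    (q : jet R) : Prop :=
  A q /\ forall p : jet R, A p -> J q <= J p.

Definition convexity_lower_bound (R : realType) (T eps M lam alpha beta C : R)
    (h : jet R) : R :=
  C * (\int[leb2 R]_(p in Omega eps M T)
         (expR (- (2 * lam * (p.1 + alpha * p.2))) *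
          (h 1%N 0%N p ^+ 2 + h 0%N 1%N p ^+ 2 + h 0%N 0%N p ^+ 2)))
  + C * (\int[@lebesgue_measure R]_(x in `]eps, M[)
           (expR (- (2 * lam * x)) *
            (h 1%N 0%N (x, 0) ^+ 2 + h 0%N 0%N (x, 0) ^+ 2)))
  + beta / 2 * norm5 eps M T h ^+ 2.

(* lam1 is a convexity threshold for the parameters (rad, T, eps, cup,       *)
(* alpha, M).  Neither lam1 nor C may depend on the data (g0, g1).  The      *)
(* minimizer is unique as a function on the closed rectangle.                *)
Definition convexity_threshold (R : realType)
    (rad T eps cup alpha M lam1 : R) : Prop :=
  1 <= lam1 /\
  exists2 C : R, 0 < C &
    forall (g0 g1 : R -> R) (lam beta : R),
      lam1 <= lam -> 2 * expR (- (lam * alpha * T)) <= beta < 1 ->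
      let A := ball_admissible rad T eps M cup g0 g1 in
      let J := Jfun T eps M lam alpha beta in
      (forall q : jet R, A q ->
         exists2 d : jet R, frechet_gradient T eps M A J q d &
           forall h : jet R, A (q + h) ->
             convexity_lower_bound T eps M lam alpha beta C h <=
             J (q + h) - J q - dot5 eps M T d h) /\
      ((exists q : jet R, A q) ->
         exists2 q : jet R, minimizer A J q &
           forall q' : jet R, minimizer A J q' ->
             forall p : R * R, cOmega eps M T p -> q' 0%N 0%N p = q 0%N 0%N p).

(* Main.v *)
Require Import Defs.
From mathcomp Require Import all_boot all_order all_algebra.
From mathcomp Require Import all_classical all_reals all_analysis.
From mathcomp Require Import measurable_realfun ring lra.

(** The minimizer [qmin] is compared with a competitor [qhat] that carries the
    noisy data and is close to the exact solution [qs].  Write [h = qhat - qmin] and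
    [r = qhat - qs].  Since the admissible set is convex, the derivative of the
    functional at its minimizer is nonnegative in the direction [h]
    (lemma [minimizer_gradient_ge0]), so the convexity inequality bounds the
    Carleman-weighted norms of [h] by [J qhat].  On the other hand [F qs = 0],
    hence [F qhat] is controlled by [r] alone (lemmas [Fop_pointwise] and
    [Jfun_le]); as the norm of [r] is O(delta) and [beta = 2 delta^2], this
    gives [J qhat = O(delta^2)].  The weight is at least
    exp(-2 lam (M + alpha T0)) on the smaller rectangle and exp(-2 lam M) on the
    side t = 0, and lam was chosen so that dividing delta^2 by these numbers
    leaves exactly delta^(2 rho1) and delta^(2 rho2) (lemma [weight_deltaE]).
    Finally [qs - qmin = h - r], and the estimate for the coefficients follows
    because q |-> 1 / (16 q^4) is smooth away from 0.

    The natural competitor [qs + Gd - Gs] has the right boundary data but may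
    violate the constraint q(x,0) >= qlow by O(delta) wherever [qs] touches the
    obstacle.  This is repaired by adding a multiple of order delta of the
    polynomial (x - eps)^2 (x - M)^2, which satisfies the homogeneous boundary
    conditions and is positive inside the interval.  Near the end points no
    repair is needed: the coefficient is continuous and equal to 1 outside
    [eps, M], so qs(eps,0) = qs(M,0) = 1/2, which exceeds qlow by a fixed
    amount, and the slope of qs(.,0) is bounded in terms of the radius of the
    ball.  This argument requires delta to be below a threshold that depends on the
    parameters only; above it, both functions lie in the same ball and the
    estimates hold because delta is bounded below (lemma [stability_sqr]).

    The analytic tools are the bounds of q and q_x on the closed rectangle by
    the norm of H^5 ([H5_sup_bound]), obtained by applying the one-dimensional
    Sobolev inequality in each variable and Tonelli's theorem, the
    differentiability of the traces ([is_derive_trace0]), and integration by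
    parts against test functions, which shows that the correcting polynomial is
    in H^5 ([H5_poly_jet]). *)

Set Implicit Arguments.
Unset Strict Implicit.
Unset Printing Implicit Defensive.

Import Order.TTheory GRing.Theory Num.Theory.
Import numFieldNormedType.Exports.

Local Open Scope classical_set_scope.
Local Open Scope ring_scope.

(** * Square-integrable functions on the plane *)

Lemma sqr_le_norm (R : realDomainType) (a K : R) :
  `|a| <= K -> a ^+ 2 <= K ^+ 2.
Proof. by rewrite ler_norml => /andP[]; nra. Qed.

(** [lebesgue_measure] lives on [measurableTypeR R]; the product of two copies of
    it is the measurable space of [leb2], whereas [R * R] is given another
    display. *)
Notation plane R := (measurableTypeR R * measurableTypeR R)%type.

Section SquareIntegrable.
Context (R : realType).
Implicit Types (U V : set (plane R)) (f g : plane R -> R).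

Lemma sqint_measurable U f : square_integrable U f -> measurable_fun U f.
Proof. by case. Qed.

Lemma sqint_sqr U f : square_integrable U f ->
  (leb2 R).-integrable U (EFin \o (fun p => f p ^+ 2)).
Proof.
move=> sf; have mf := sqint_measurable sf; case: sf => _ fi.
apply/integrableP; split.
  by apply/measurable_EFinP; exact: measurable_funX.
by under eq_integral => p _ do rewrite /= ger0_norm ?sqr_ge0//.
Qed.

(** By the inequality |f g| <= f^2 + g^2. *)
Lemma sqint_mul_integrable U f g : measurable U ->
  square_integrable U f -> square_integrable U g ->
  (leb2 R).-integrable U (EFin \o (fun p => f p * g p)).
Proof.
move=> mU fi gi.
have := integrableD mU (sqint_sqr fi) (sqint_sqr gi).
apply: le_integrable => //.
  by apply/measurable_EFinP/measurable_funM; exact: sqint_measurable.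
move=> p _ /=; rewrite lee_fin [leRHS]ger0_norm ?addr_ge0 ?sqr_ge0// normrM.
rewrite -(real_normK (num_real (f p))) -(real_normK (num_real (g p))).
by have := sqr_ge0 (`|f p| - `|g p|); have := sqr_ge0 (`|f p| + `|g p|); nra.
Qed.

Lemma sqint_of_integrable U f : measurable_fun U f ->
  (leb2 R).-integrable U (EFin \o (fun p => f p ^+ 2)) -> square_integrable U f.
Proof.
move=> mf /integrableP[_ fi]; split => //.
by under eq_integral => p _ do rewrite -[f p ^+ 2]ger0_norm ?sqr_ge0//.
Qed.

Lemma sqintD U f g : measurable U ->
  square_integrable U f -> square_integrable U g ->
  square_integrable U (fun p => f p + g p).
Proof.
move=> mU fi gi; have mf := sqint_measurable fi; have mg := sqint_measurable gi.
apply: sqint_of_integrable; first exact: measurable_funD.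
have := integrableD mU (integrableD mU (sqint_sqr fi) (sqint_sqr gi))
  (integrableD mU (sqint_sqr fi) (sqint_sqr gi)).
apply: le_integrable => //.
  by apply/measurable_EFinP/measurable_funX; exact: measurable_funD.
move=> p _ /=; rewrite lee_fin !ger0_norm ?addr_ge0 ?sqr_ge0//.
by have := sqr_ge0 (f p - g p); nra.
Qed.

Lemma sqint_bounded_mul U f (h : plane R -> R) (K : R) : measurable U ->
  measurable_fun U h -> (forall p, U p -> `|h p| <= K) ->
  square_integrable U f -> square_integrable U (fun p => h p * f p).
Proof.
move=> mU mh hK fi; have mf := sqint_measurable fi.
apply: sqint_of_integrable; first exact: measurable_funM.
have := integrableZl mU (K ^+ 2) (sqint_sqr fi).
apply: le_integrable => //.
  by apply/measurable_EFinP/measurable_funX; exact: measurable_funM.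
move=> p Up /=; rewrite lee_fin !ger0_norm ?sqr_ge0 ?(mulr_ge0 (sqr_ge0 _) (sqr_ge0 _))//.
by rewrite exprMn; apply: ler_wpM2r; [exact: sqr_ge0|exact/sqr_le_norm/hK].
Qed.

Lemma sqintZ U f (a : R) : measurable U ->
  square_integrable U f -> square_integrable U (fun p => a * f p).
Proof.
by move=> mU; apply: (@sqint_bounded_mul _ _ (cst a) `|a|).
Qed.

Lemma sqint_bounded U f (K : R) : measurable U -> (leb2 R U < +oo)%E ->
  measurable_fun U f -> (forall p, U p -> `|f p| <= K) ->
  square_integrable U f.
Proof.
move=> mU Ufin mf fK; apply: sqint_of_integrable => //.
apply: measurable_bounded_integrable => //; first exact: measurable_funX.
exists (K ^+ 2); split; first exact: num_real.
move=> y Ky p Up /=; rewrite (le_trans _ (ltW Ky))//.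
by rewrite ger0_norm ?sqr_ge0//; exact/sqr_le_norm/fK.
Qed.

Lemma sqintS U V f : measurable U -> measurable V -> V `<=` U ->
  square_integrable U f -> square_integrable V f.
Proof.
move=> mU mV VU sf; have mf := sqint_measurable sf; case: sf => _ fi.
split; first exact: measurable_funS VU mf.
apply: le_lt_trans fi; apply: ge0_subset_integral => //.
  by apply/measurable_EFinP/measurable_funX.
by move=> p _; rewrite lee_fin sqr_ge0.
Qed.

End SquareIntegrable.

Section Rectangle.
Context (R : realType).

Lemma Omega_setX (a b c : R) : Omega a b c = `]a, b[ `*` `]0, c[.
Proof. by apply/seteqP; split => -[x t] /=; rewrite !in_itv. Qed.

Lemma measurable_Omega (a b c : R) : measurable (Omega a b c : set (plane R)).
Proof. by rewrite Omega_setX; exact: measurableX. Qed.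

Lemma leb2_Omega_fin (a b c : R) : (leb2 R (Omega a b c) < +oo)%E.
Proof.
rewrite Omega_setX /leb2 product_measure1E//.
rewrite [X in (X * _)%E]lebesgue_measure_itv [X in (_ * X)%E]lebesgue_measure_itv /=.
by case: ifP => _; case: ifP => _; rewrite ?mul0e ?mule0 -?EFinB -?EFinM ltry.
Qed.

(** An open set is the countable union of the squares with rational centre and
    radius that it contains. *)
Lemma open_measurable2 (A : set (R * R)) : open A -> measurable (A : set (plane R)).
Proof.
move=> oA.
pose box (k a b : R) := ball a k `*` ball b k.
pose P (k a b : R) := box k a b `<=` A.
have -> : A = \bigcup_(k : rat) \bigcup_(a : rat) \bigcup_(b : rat)
    (if `[< P (ratr k) (ratr a) (ratr b) >]
     then box (ratr k) (ratr a) (ratr b) else set0).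
  apply/seteqP; split => [[x t] Ap|p [k _] [a _] [b _]]; last first.
    by case: asboolP => // kA; exact: kA.
  have /nbhs_ballP[e /= e0 eA] : nbhs (x, t) A by exact: open_nbhs_nbhs.
  have [k /[!in_itv]/= /andP[k0 ke]] : exists k : rat, ratr k \in `]0, e / 2[.
    by apply: rat_in_itvoo; rewrite divr_gt0.
  have [a /[!in_itv]/= /andP[xa ax]] : exists a : rat, ratr a \in `]x - ratr k, x + ratr k[.
    by apply: rat_in_itvoo; rewrite ltrD2l gtrN.
  have [b /[!in_itv]/= /andP[tb bt]] : exists b : rat, ratr b \in `]t - ratr k, t + ratr k[.
    by apply: rat_in_itvoo; rewrite ltrD2l gtrN.
  have xak : ball (ratr a : R) (ratr k : R) x.
    by rewrite /ball/= ltr_norml; apply/andP; split; lra.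
  have tbk : ball (ratr b : R) (ratr k : R) t.
    by rewrite /ball/= ltr_norml; apply/andP; split; lra.
  exists k => //; exists a => //; exists b => //.
  rewrite asboolT// => -[y s] [/= ya sb].
  by apply: eA; split => /=;
    [apply: le_ball (ball_triangle (ball_sym xak) ya)
    |apply: le_ball (ball_triangle (ball_sym tbk) sb)]; lra.
apply: bigcupT_measurable_rat => k; apply: bigcupT_measurable_rat => a.
apply: bigcupT_measurable_rat => b; case: ifP => // _.
by apply: measurableX; apply: measurable_ball.
Qed.

Lemma continuous_measurable2 (f : R * R -> R) :
  continuous f -> measurable_fun setT (f : plane R -> R).
Proof.
move=> /continuousP cf; apply: (measurability _ (RGenOpens.measurableE R)).
move=> _ [_ [a [b ->] <-]]; rewrite setTI; apply: open_measurable2.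
exact/cf/interval_open.
Qed.

End Rectangle.

(** * The fundamental theorem of calculus and Tonelli on a rectangle *)

Section Integrals.
Context d (T : measurableType d) (R : realType).
Variable mu : {measure set T -> \bar R}.
Implicit Types (A B D : set T) (f g : T -> R).

Lemma le_subset_Rintegral A B f g : measurable A -> measurable B -> A `<=` B ->
  mu.-integrable A (EFin \o f) -> mu.-integrable B (EFin \o g) ->
  (forall p, B p -> 0 <= g p) -> (forall p, A p -> f p <= g p) ->
  \int[mu]_(p in A) f p <= \int[mu]_(p in B) g p.
Proof.
move=> mA mB AB fi gi g0 fg.
have gAi : mu.-integrable A (EFin \o g) by exact: integrableS gi.
apply: (le_trans (le_Rintegral mA fi gAi fg)).
rewrite /Rintegral fine_le//; [exact: integrable_fin_num|exact: integrable_fin_num|].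
by apply: ge0_subset_integral => //; exact: measurable_int gi.
Qed.

End Integrals.

Section Segment.
Context (R : realType).
Notation mu := (@lebesgue_measure R).
Implicit Types (a b u v : R) (F f : R -> R).

Lemma within_itv_integrable a b f : {within `[a, b], continuous f} ->
  mu.-integrable `[a, b] (EFin \o f).
Proof. by move=> cf; apply: continuous_compact_integrable => //; exact: segment_compact. Qed.

Lemma within_itv_integrable_oo a b f : {within `[a, b], continuous f} ->
  mu.-integrable `]a, b[ (EFin \o f).
Proof.
move=> /within_itv_integrable; apply: integrableS => //.
exact: subset_itv_oo_cc.
Qed.

Lemma Rintegral_itv_oo_cc a b f : {within `[a, b], continuous f} ->
  \int[mu]_(x in `]a, b[) f x = \int[mu]_(x in `[a, b]) f x.
Proof.
move=> cf; rewrite Rintegral_itv_bndo_bndc; last exact: within_itv_integrable_oo.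
rewrite Rintegral_itv_obnd_cbnd//.
apply: integrableS (within_itv_integrable cf) => //.
exact: subset_itv_oc_cc.
Qed.

Lemma FTC_within a b F f : a < b ->
  {within `[a, b], continuous F} -> {within `[a, b], continuous f} ->
  (forall x, x \in `]a, b[ -> is_derive x 1 F (f x)) ->
  \int[mu]_(x in `[a, b]) f x = F b - F a.
Proof.
move=> ab cF cf dF; rewrite /Rintegral (@continuous_FTC2 _ f F)//.
- split; first by move=> x /dF [].
  + by have /(continuous_within_itvP _ ab)[] := cF.
  + by have /(continuous_within_itvP _ ab)[] := cF.
- by move=> x /dF dFx; rewrite derive1E; exact: derive_val.
Qed.

Lemma within_sqr_sum a b F f : {within `[a, b], continuous F} ->
  {within `[a, b], continuous f} ->
  {within `[a, b], continuous (fun x => F x ^+ 2 + f x ^+ 2)}.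
Proof. by move=> cF cf x; apply: cvgD; apply: cvgM; (exact: cF || exact: cf). Qed.

(** (F^2)' = 2 F f, and 2 |F f| <= F^2 + f^2. *)
Lemma sqr_variation_le a b u v F f : a <= u -> u <= v -> v <= b ->
  {within `[a, b], continuous F} -> {within `[a, b], continuous f} ->
  (forall x, x \in `]a, b[ -> is_derive x 1 F (f x)) ->
  `|F v ^+ 2 - F u ^+ 2| <= \int[mu]_(x in `[a, b]) (F x ^+ 2 + f x ^+ 2).
Proof.
move=> au uv vb cF cf dF.
have I0 : 0 <= \int[mu]_(x in `[a, b]) (F x ^+ 2 + f x ^+ 2).
  by apply: Rintegral_ge0 => x _; rewrite addr_ge0 ?sqr_ge0.
move: uv; rewrite le_eqVlt => /predU1P[->|uv]; first by rewrite subrr normr0.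
have sub : `[u, v] `<=` `[a, b] by apply: subset_itv; rewrite bnd_simp.
have cF' := continuous_subspaceW sub cF; have cf' := continuous_subspaceW sub cf.
have cg : {within `[u, v], continuous (fun x => 2 * F x * f x)}.
  by move=> x; apply: cvgM; [apply: cvgM; [exact: cvg_cst|exact: cF']|exact: cf'].
have gi := within_itv_integrable cg.
have Gi := within_itv_integrable (within_sqr_sum cF cf).
have <- : \int[mu]_(x in `[u, v]) (2 * F x * f x) = F v ^+ 2 - F u ^+ 2.
  have cF2 : {within `[u, v], continuous (fun x => F x ^+ 2)}.
    by move=> x; apply: cvgM; exact: cF'.
  have dF2 x : x \in `]u, v[ -> is_derive x 1 (fun x => F x ^+ 2) (2 * F x * f x).
    move=> /[!in_itv]/= /andP[ux xv].
    have dFx : is_derive x 1 F (f x).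
      by apply: dF; rewrite in_itv/=; apply/andP; split; lra.
    by apply: is_derive_eq; rewrite /GRing.scale/=; ring.
  exact: (FTC_within uv cF2 cg dF2).
apply: le_trans (le_normr_Rintegral _ gi) _ => //.
apply: le_subset_Rintegral => //.
- exact: (integrable_norm gi).
- by move=> p _; rewrite addr_ge0 ?sqr_ge0.
- move=> p _; rewrite ler_norml.
  by have := sqr_ge0 (F p + f p); have := sqr_ge0 (F p - f p); nra.
Qed.

(** One-dimensional Sobolev inequality: the minimum of F^2 is at most its mean,
    and the variation of F^2 is bounded by [sqr_variation_le]. *)
Lemma sqr_le_Rintegral a b F f (x : R) : a < b -> x \in `[a, b] ->
  {within `[a, b], continuous F} -> {within `[a, b], continuous f} ->
  (forall x, x \in `]a, b[ -> is_derive x 1 F (f x)) ->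
  F x ^+ 2 <= ((b - a)^-1 + 1) *
     \int[mu]_(y in `]a, b[) (F y ^+ 2 + f y ^+ 2).
Proof.
move=> ab xab cF cf dF.
have cG := within_sqr_sum cF cf.
rewrite (Rintegral_itv_oo_cc cG).
set I := Rintegral _ _ _.
have cF2 : {within `[a, b], continuous (fun x => F x ^+ 2)}.
  by move=> y; apply: cvgM; exact: cF.
(* y realizes the minimum of F^2. *)
have [y yab ymin] := EVT_min (ltW ab) cF2.
have ba : 0 < b - a by rewrite subr_gt0.
have yI : F y ^+ 2 <= (b - a)^-1 * I.
  rewrite mulrC ler_pdivlMr//.
  have -> : F y ^+ 2 * (b - a) = \int[mu]_(z in `[a, b]) (F y ^+ 2).
    by rewrite Rintegral_cst//= lebesgue_measure_itv/= lte_fin ab.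
  apply: le_Rintegral => //.
  - by apply: within_itv_integrable; exact: cst_continuous.
  - exact: within_itv_integrable.
  - move=> z zab; apply: le_trans (ymin _ zab) _.
    by rewrite lerDl sqr_ge0.
rewrite mulrDl mul1r -lerBlDl; apply: le_trans (lerB (lexx _) yI) _.
apply: le_trans (ler_norm _) _.
move: xab yab; rewrite !in_itv/= => /andP[ax xb] /andP[ay yb].
have [xy|yx] := leP x y; last exact: (sqr_variation_le ay (ltW yx) xb).
by rewrite distrC; exact: (sqr_variation_le ax xy yb).
Qed.

End Segment.

Section Fubini.
Context (R : realType).
Notation mu := (@lebesgue_measure R).
Implicit Types (a b c : R).

Lemma patch_lines a b c (G : plane R -> \bar R) (x t : R) :
  (G \_ (Omega a b c)) (x, t) =
  (if x \in `]a, b[ then (if t \in `]0, c[ then G (x, t) else 0%E) else 0%E).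
Proof.
rewrite patchE /Omega !in_itv/=; case: ifPn.
  by rewrite inE/= => -[-> ->].
rewrite notin_setE/=; case: ifP => // ax; case: ifP => // tc.
by case.
Qed.

Lemma fubini_F_Omega a b c (G : plane R -> \bar R) (x : R) :
  fubini_F mu (G \_ (Omega a b c)) x =
  ((fun x => (\int[mu]_(t in `]0%R, c[) G (x, t))%E) \_ `]a, b[) x.
Proof.
rewrite /fubini_F patchE mem_setE; under eq_integral do rewrite patch_lines.
case: ifPn => xab; last by rewrite integral0.
rewrite [RHS]integral_mkcond; apply: eq_integral => t _.
by rewrite patchE mem_setE.
Qed.

Lemma measurable_inner a b c (G : plane R -> \bar R) :
  measurable_fun (Omega a b c : set (plane R)) G ->
  (forall p, Omega a b c p -> (0 <= G p)%E) ->
  measurable_fun `]a, b[ (fun x => (\int[mu]_(t in `]0%R, c[) G (x, t))%E).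
Proof.
move=> mG G0; apply/(measurable_restrictT _ (measurable_itv _)).
have -> : (fun x => (\int[mu]_(t in `]0%R, c[) G (x, t))%E) \_ `]a, b[ =
    fubini_F mu (G \_ (Omega a b c)).
  by apply/funext => x; rewrite fubini_F_Omega.
apply: measurable_fun_fubini_tonelli_F.
  by exact/(measurable_restrictT _ (measurable_Omega _ _ _)).
by move=> p; rewrite patchE; case: ifPn => //; rewrite inE => /G0.
Qed.

Lemma tonelli_Omega a b c (G : plane R -> \bar R) :
  measurable_fun (Omega a b c : set (plane R)) G ->
  (forall p, Omega a b c p -> (0 <= G p)%E) ->
  (\int[leb2 R]_(p in Omega a b c) G p =
  \int[mu]_(x in `]a, b[) \int[mu]_(t in `]0%R, c[) G (x, t))%E.
Proof.
move=> mG G0; rewrite integral_mkcond [RHS]integral_mkcond.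
rewrite /leb2 fubini_tonelli1.
- by apply: eq_integral => x _; exact: fubini_F_Omega.
- by exact/(measurable_restrictT _ (measurable_Omega _ _ _)).
- by move=> p; rewrite patchE; case: ifPn => //; rewrite inE => /G0.
Qed.

End Fubini.

(** * Sobolev embedding on a rectangle and traces on t = 0 *)

Section Lines.
Context (R : realType).
Implicit Types (a b c x t : R) (f : R * R -> R).

Lemma cOmega_line_x a b c f t : {within cOmega a b c, continuous f} ->
  0 <= t <= c -> {within `[a, b], continuous (fun x => f (x, t))}.
Proof.
move=> /subspace_continuousP cf tc; apply/subspace_continuousP => x /= xab.
have {}cf : f @ within (cOmega a b c) (nbhs (x, t)) --> f (x, t).
  by apply: cf; move: xab; rewrite in_itv.
apply/cvgrPdist_lt => e e0; move/cvgrPdist_lt : cf => /(_ _ e0).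
rewrite !near_withinE => /nbhs_ballP[r /= r0 rf].
apply/nbhs_ballP; exists r => //= y xy yab; apply: rf => /=.
  by split => //; exact: ballxx.
by move: yab; rewrite in_itv.
Qed.

Lemma cOmega_line_t a b c f x : {within cOmega a b c, continuous f} ->
  a <= x <= b -> {within `[0, c], continuous (fun t => f (x, t))}.
Proof.
move=> /subspace_continuousP cf xab; apply/subspace_continuousP => t /= tc.
have {}cf : f @ within (cOmega a b c) (nbhs (x, t)) --> f (x, t).
  by apply: cf; move: tc; rewrite in_itv.
apply/cvgrPdist_lt => e e0; move/cvgrPdist_lt : cf => /(_ _ e0).
rewrite !near_withinE => /nbhs_ballP[r /= r0 rf].
apply/nbhs_ballP; exists r => //= s ts sc; apply: rf => /=.
  by split => //; exact: ballxx.
by move: sc; rewrite in_itv.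
Qed.

Lemma le_closure_itv a b (g : R -> R) (B : R) : a < b ->
  {within `[a, b], continuous g} ->
  (forall x, a < x < b -> g x <= B) -> forall x, a <= x <= b -> g x <= B.
Proof.
move=> ab /(continuous_within_itvP _ ab)[_ ga gb] gB x /andP[].
rewrite le_eqVlt => /predU1P[<- _|ax].
  apply: cvgr_to_le ga _.
  by apply: filterS2 (nbhs_right_gt a) (nbhs_right_lt ab) => y ay yb; apply: gB; rewrite ay.
rewrite le_eqVlt => /predU1P[->|xb].
  apply: cvgr_to_le gb _.
  by apply: filterS2 (nbhs_left_lt b) (nbhs_left_gt ab) => y yb ay; apply: gB; rewrite ay.
by have := gB x; rewrite ax xb; exact.
Qed.

(** A bound inside the rectangle passes to the boundary along lines, first in x
    and then in t. *)
Lemma le_closure_Omega a b c f (B : R) : a < b -> 0 < c ->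
  {within cOmega a b c, continuous f} ->
  (forall p, Omega a b c p -> f p <= B) ->
  forall p, cOmega a b c p -> f p <= B.
Proof.
move=> ab c0 cf fB [x t] /= [xab tc].
apply: (le_closure_itv c0 (cOmega_line_t cf xab)) tc => s s0.
have s0' : 0 <= s <= c by case/andP: s0 => /ltW -> /ltW ->.
by apply: (le_closure_itv ab (cOmega_line_x cf s0')) xab => y yab; exact: fB.
Qed.

Lemma measurable_itvR (i : interval R) :
  measurable ([set` i] : set (measurableTypeR R)).
Proof. exact: measurable_itv. Qed.

(** Constant of [sqr_le_Rintegral] on an interval of length [l]. *)
Definition sobolev_const_1d (l : R) := l^-1 + 1.

Lemma sobolev_const_1d_gt0 l : 0 < l -> 0 < sobolev_const_1d l.
Proof. by move=> l0; rewrite addr_gt0 ?invr_gt0. Qed.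

(** The one-dimensional inequality in x, followed by the one in t for f and for
    its derivative in x on each vertical line: hence the mixed derivative. *)
Lemma sqr_le_Rintegral_Omega a b c (f fx ft fxt : plane R -> R) :
  a < b -> 0 < c ->
  {within cOmega a b c, continuous f} -> {within cOmega a b c, continuous fx} ->
  {within cOmega a b c, continuous ft} -> {within cOmega a b c, continuous fxt} ->
  (forall p, Omega a b c p ->
     [/\ is_derive p.1 1 (fun x : R => f (x, p.2)) (fx p),
         is_derive p.2 1 (fun t : R => f (p.1, t)) (ft p)
       & is_derive p.2 1 (fun t : R => fx (p.1, t)) (fxt p)]) ->
  square_integrable (Omega a b c) f -> square_integrable (Omega a b c) fx ->
  square_integrable (Omega a b c) ft -> square_integrable (Omega a b c) fxt ->
  forall p, cOmega a b c p -> f p ^+ 2 <= sobolev_const_1d (b - a) * sobolev_const_1d c *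
    \int[leb2 R]_(p in Omega a b c)
      ((f p ^+ 2 + ft p ^+ 2) + (fx p ^+ 2 + fxt p ^+ 2)).
Proof.
move=> ab c0 cf cfx cft cfxt df sf sfx sft sfxt.
have mO : measurable (Omega a b c : set (plane R)) by exact: measurable_Omega.
have ba0 : 0 < b - a by rewrite subr_gt0.
apply: le_closure_Omega => //.
  by move=> p; apply: cvgM; exact: cf.
move=> [x t] /= [xab tc].
set G := fun p : plane R => _ : R.
have G0 p : 0 <= G p by rewrite !addr_ge0 ?sqr_ge0.
have Gi : (leb2 R).-integrable (Omega a b c) (EFin \o G).
  have := integrableD mO (integrableD mO (sqint_sqr sf) (sqint_sqr sft))
    (integrableD mO (sqint_sqr sfx) (sqint_sqr sfxt)).
  exact.
have xab' : a <= x <= b by case/andP: xab => /ltW -> /ltW ->.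
have tc' : 0 <= t <= c by case/andP: tc => /ltW -> /ltW ->.
pose H y := f (y, t) ^+ 2 + fx (y, t) ^+ 2.
have cH : {within `[a, b], continuous H}.
  by apply: within_sqr_sum; apply: cOmega_line_x tc'; eassumption.
have step1 : f (x, t) ^+ 2 <=
    sobolev_const_1d (b - a) * \int[@lebesgue_measure R]_(y in `]a, b[) H y.
  apply: (@sqr_le_Rintegral _ a b (fun y => f (y, t)) (fun y => fx (y, t)) x) => //.
  - by apply: cOmega_line_x tc'; eassumption.
  - by apply: cOmega_line_x tc'; eassumption.
  - move=> y; rewrite in_itv/= => yab; have [] := df (y, t) _ => //.
have step2 y : a < y < b ->
    ((H y)%:E <= (sobolev_const_1d c)%:E *
      \int[@lebesgue_measure R]_(s in `]0%R, c[) (G (y, s))%:E)%E.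
  move=> yab; have yab' : a <= y <= b by case/andP: yab => /ltW -> /ltW ->.
  have line (g : R * R -> R) : {within cOmega a b c, continuous g} ->
      {within `[0, c], continuous (fun s => g (y, s))}.
    by move=> cg; exact: cOmega_line_t cg yab'.
  have i1 := within_itv_integrable_oo (within_sqr_sum (line _ cf) (line _ cft)).
  have i2 := within_itv_integrable_oo (within_sqr_sum (line _ cfx) (line _ cfxt)).
  have i3 : (@lebesgue_measure R).-integrable `]0, c[ (EFin \o (fun s => G (y, s))).
    by have := integrableD (measurable_itvR _) i1 i2.
  have <- : ((sobolev_const_1d c * \int[@lebesgue_measure R]_(s in `]0%R, c[) G (y, s))%:E =
    (sobolev_const_1d c)%:E * \int[@lebesgue_measure R]_(s in `]0%R, c[) (G (y, s))%:E)%E.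
    by rewrite EFinM /Rintegral fineK//; exact: integrable_fin_num.
  rewrite lee_fin /G RintegralD// mulrDr /H /sobolev_const_1d -[c in c^-1]subr0.
  have tI : t \in `[0, c] by rewrite in_itv.
  apply: lerD.
    apply: (sqr_le_Rintegral c0 tI (line _ cf) (line _ cft)).
    by move=> s; rewrite in_itv/= => sc; have [] := df (y, s) _.
  apply: (sqr_le_Rintegral c0 tI (line _ cfx) (line _ cfxt)).
  by move=> s; rewrite in_itv/= => sc; have [] := df (y, s) _.
rewrite -mulrA (le_trans step1)// ler_pM2l ?sobolev_const_1d_gt0//.
rewrite -lee_fin EFinM /Rintegral !fineK; last 2 first.
  exact: integrable_fin_num.
  by apply: integrable_fin_num => //; exact: within_itv_integrable_oo.
have mG : measurable_fun (Omega a b c : set (plane R)) (EFin \o G).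
  by case/integrableP: Gi.
have pG p : Omega a b c p -> (0 <= (EFin \o G) p)%E by rewrite /= lee_fin.
have mI := measurable_inner mG pG.
rewrite (tonelli_Omega mG pG) -ge0_integralZl//; last 2 first.
  by move=> y _; apply: integral_ge0 => s _; rewrite lee_fin.
  by rewrite lee_fin ltW ?sobolev_const_1d_gt0.
apply: ge0_le_integral => //.
- by move=> y _; rewrite lee_fin addr_ge0 ?sqr_ge0.
- by apply: (@measurable_int _ _ _ (@lebesgue_measure R)); exact: within_itv_integrable_oo.
- exact: measurable_funeM.
Qed.

End Lines.

Section Jets.
Context (R : realType).
Variables (eps M T : R).
Hypotheses (epsM : eps < M) (T0 : 0 < T).
Notation Om := (Omega eps M T).
Notation cOm := (cOmega eps M T).
Implicit Types (q h : jet R).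

Lemma H5_sqint q i j : H5 eps M T q -> (i + j <= 5)%N ->
  square_integrable Om (q i j).
Proof. by case=> + _ _ => /[apply] -[]. Qed.

Lemma H5_cont q i j : H5 eps M T q -> (i + j <= 3)%N ->
  {within cOm, continuous (q i j)}.
Proof. by case=> _ + _ => /[apply]. Qed.

Lemma sob_dot_ge0 k U q : 0 <= sob_dot k U q q.
Proof.
apply: sumr_ge0 => i _; apply: sumr_ge0 => j _; apply: Rintegral_ge0 => p _.
by rewrite -expr2 sqr_ge0.
Qed.

Lemma sob_norm_sqr k U q : sob_norm k U q ^+ 2 = sob_dot k U q q.
Proof. by rewrite /sob_norm sqr_sqrtr// sob_dot_ge0. Qed.

Lemma le_sob_dot k U q i j : (i + j <= k)%N ->
  \int[leb2 R]_(p in U) (q i j p ^+ 2) <= sob_dot k U q q.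
Proof.
move=> ijk; have ik : (i < k.+1)%N by rewrite ltnS (leq_trans (leq_addr _ _) ijk).
have jk : (j < k.+1)%N by rewrite ltnS (leq_trans (leq_addl _ _) ijk).
have E p : q i j p ^+ 2 = q i j p * q i j p by rewrite expr2.
under eq_Rintegral do rewrite E.
rewrite /sob_dot (bigD1 (Ordinal ik))//= (bigD1 (Ordinal jk))//= -addrA lerDl.
rewrite addr_ge0//.
  by apply: sumr_ge0 => l _; apply: Rintegral_ge0 => p _; rewrite -expr2 sqr_ge0.
apply: sumr_ge0 => m _; apply: sumr_ge0 => l _; apply: Rintegral_ge0 => p _.
by rewrite -expr2 sqr_ge0.
Qed.

(** The factor 4 counts the derivatives 00, 10, 01, 11 of
    [sqr_le_Rintegral_Omega], each bounded by the H^5 norm. *)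
Definition sobolev_const : R := 4 * (sobolev_const_1d (M - eps) * sobolev_const_1d T).

Lemma sobolev_const_gt0 : 0 < sobolev_const.
Proof. by rewrite !mulr_gt0 ?sobolev_const_1d_gt0 ?subr_gt0. Qed.

(** The orders i = 0 and i = 1 are those for which the mixed derivative of
    [q i 0] still has order at most 3, hence is classical. *)
Lemma H5_sup_bound q i : H5 eps M T q -> (i <= 1)%N ->
  forall p, cOm p -> q i 0%N p ^+ 2 <= sobolev_const * dot5 eps M T q q.
Proof.
move=> Hq i1 p cp.
have s k l : (k + l <= 5)%N -> square_integrable Om (q k l) by exact: H5_sqint.
have c k l : (k + l <= 3)%N -> {within cOm, continuous (q k l)} by exact: H5_cont.
have i3 : (i.+1 + 1 <= 3)%N by case: i i1 => [|[|]].
have h1 : (i + 0 <= 3)%N by case: i i1 i3 => [|[|]].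
have h2 : (i.+1 + 0 <= 3)%N by case: i i1 i3 h1 => [|[|]].
have h3 : (i + 1 <= 3)%N by case: i i1 i3 h1 h2 => [|[|]].
have w (n : nat) : (n <= 3 -> n <= 5)%N by move=> /leq_trans; apply.
have := @sqr_le_Rintegral_Omega _ eps M T (q i 0%N) (q i.+1 0%N) (q i 1%N) (q i.+1 1%N)
  epsM T0 (c _ _ h1) (c _ _ h2) (c _ _ h3) (c _ _ i3) _ (s _ _ (w _ h1))
  (s _ _ (w _ h2)) (s _ _ (w _ h3)) (s _ _ (w _ i3)) p cp.
move=> /(_ _)/le_trans; apply.
  case: Hq => _ _ d z Oz.
  have [|d1 d2] := d i 0%N _ z Oz; first by case: i i1 {i3 h1 h2 h3} => [|[|]].
  have [|_ d3] := d i.+1 0%N _ z Oz; first by case: i i1 {i3 h1 h2 h3 d1 d2} => [|[|]].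
  by [].
rewrite /sobolev_const [4 * _]mulrC -!mulrA ler_pM2l ?sobolev_const_1d_gt0 ?subr_gt0//.
rewrite ler_pM2l ?sobolev_const_1d_gt0//.
have i5 k l (kl : (k + l <= 5)%N) := sqint_sqr (s k l kl).
have m := measurable_Omega eps M T.
have ii k1 l1 k2 l2 (h : (k1 + l1 <= 3)%N) (h' : (k2 + l2 <= 3)%N) :=
  integrableD m (i5 _ _ (w _ h)) (i5 _ _ (w _ h')).
rewrite (RintegralD m (ii _ _ _ _ h1 h3) (ii _ _ _ _ h2 i3)).
rewrite (RintegralD m (i5 _ _ (w _ h1)) (i5 _ _ (w _ h3))).
rewrite (RintegralD m (i5 _ _ (w _ h2)) (i5 _ _ (w _ i3))).
have L k l (kl : (k + l <= 5)%N) := @le_sob_dot 5 Om q k l kl.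
have := L _ _ (w _ h1); have := L _ _ (w _ h2).
have := L _ _ (w _ h3); have := L _ _ (w _ i3).
rewrite /dot5; lra.
Qed.

Lemma MVT_dist (a b : R) (f df : R -> R) (D e : R) : a < b ->
  {within `[a, b], continuous f} ->
  (forall x, x \in `]a, b[ -> is_derive x 1 f (df x)) ->
  (forall x, a < x < b -> `|D - df x| <= e) ->
  `|f b - f a - D * (b - a)| <= e * (b - a).
Proof.
move=> ab cf dF De; have [c + ->] := MVT ab dF cf.
rewrite in_itv/= => /De cD.
by rewrite -mulrBl normrM (gtr0_norm (x := b - a)) ?subr_gt0// ler_pM2r ?subr_gt0// distrC.
Qed.

Lemma MVT_dist2 (a b x y : R) (f df : R -> R) (D e : R) :
  a < x < b -> a < y < b ->
  {within `[a, b], continuous f} ->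
  (forall x, x \in `]a, b[ -> is_derive x 1 f (df x)) ->
  (forall z, a < z < b -> `|z - x| <= `|y - x| -> `|D - df z| <= e) ->
  `|f y - f x - D * (y - x)| <= e * `|y - x|.
Proof.
move=> /andP[ax xb] /andP[ay yb] cf dF De.
have seg u v : a < u -> v < b -> `[u, v] `<=` `[a, b].
  by move=> au vb; apply: subset_itv; rewrite bnd_simp ltW.
have [xy|yx|->] := ltgtP x y; last by rewrite !subrr mulr0 subrr normr0 mulr0.
- have nE : `|y - x| = y - x by apply: gtr0_norm; rewrite subr_gt0.
  have c1 := continuous_subspaceW (seg _ _ ax yb) cf.
  have d1 z : z \in `]x, y[ -> is_derive z 1 f (df z).
    move=> /[!in_itv]/= /andP[xz zy]; apply: dF.
    by rewrite in_itv/=; apply/andP; split; lra.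
  have e1 z : x < z < y -> `|D - df z| <= e.
    move=> /andP[xz zy]; apply: De; first by apply/andP; split; lra.
    have -> : `|z - x| = z - x by apply: gtr0_norm; rewrite subr_gt0.
    by rewrite nE; lra.
  by rewrite nE; exact: (MVT_dist xy c1 d1 e1).
- have nE : `|y - x| = x - y by rewrite distrC; apply: gtr0_norm; rewrite subr_gt0.
  have c1 := continuous_subspaceW (seg _ _ ay xb) cf.
  have d1 z : z \in `]y, x[ -> is_derive z 1 f (df z).
    move=> /[!in_itv]/= /andP[xz zy]; apply: dF.
    by rewrite in_itv/=; apply/andP; split; lra.
  have e1 z : y < z < x -> `|D - df z| <= e.
    move=> /andP[xz zy]; apply: De; first by apply/andP; split; lra.
    have -> : `|z - x| = x - z by rewrite distrC; apply: gtr0_norm; rewrite subr_gt0.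
    by rewrite nE; lra.
  have E : f y - f x - D * (y - x) = - (f x - f y - D * (x - y)) by ring.
  by rewrite nE E normrN; exact: (MVT_dist yx c1 d1 e1).
Qed.

(** The derivatives of an element of H^5 are classical only inside the
    rectangle.  For small t > 0 the mean value theorem bounds the error of the
    difference quotient at height t by the oscillation of q_x near (x, 0); this
    bound survives the limit t -> 0. *)
Lemma is_derive_trace0 q (x : R) : H5 eps M T q -> eps < x < M ->
  is_derive x 1 (fun y : R => q 0%N 0%N (y, 0)) (q 1%N 0%N (x, 0)).
Proof.
move=> Hq /andP[ex xM].
have c0 : {within cOm, continuous (q 0%N 0%N)} by exact: H5_cont.
have c1 : {within cOm, continuous (q 1%N 0%N)} by exact: H5_cont.
have x0 : cOm (x, 0) by split; rewrite /= ?lexx !ltW.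
suff H : (fun h : R => h^-1 *: (q 0%N 0%N (h *: 1 + x, 0) - q 0%N 0%N (x, 0))) @ 0^' -->
    q 1%N 0%N (x, 0).
  by apply: DeriveDef; [apply/cvg_ex; exists (q 1%N 0%N (x, 0))|exact: cvg_lim H].
apply/cvgrPdist_le => e e0.
have /subspace_continuousP/(_ _ x0)/cvgrPdist_le/(_ _ e0) := c1.
rewrite near_withinE => /nbhs_ballP[r /= r0 rq].
pose r' := Num.min r (Num.min (x - eps) (M - x)).
have r'0 : 0 < r' by rewrite !lt_min r0 !subr_gt0 ex xM.
apply/nbhs_ballP; exists r' => //= h; rewrite /ball/= sub0r normrN => hr hn0.
have h0 : 0 < `|h| by rewrite normr_gt0.
move: hr; rewrite !lt_min => /and3P[hr he hM].
have yM : eps < h + x < M.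
  by move: he hM; rewrite !ltr_norml => /andP[? ?] /andP[? ?]; apply/andP; split; lra.
suff main : `|q 0%N 0%N (h + x, 0) - q 0%N 0%N (x, 0) - q 1%N 0%N (x, 0) * h| <= e * `|h|.
  rewrite /GRing.scale/= mulr1 -(@ler_pM2r _ `|h|)// -normrM.
  rewrite mulrBl mulrAC mulVf// mul1r distrC; exact: main.
have cg : {within `[0, Num.min T r], continuous
    (fun t : R => `|q 0%N 0%N (h + x, t) - q 0%N 0%N (x, t) - q 1%N 0%N (x, 0) * h|)}.
  apply: (@continuous_subspaceW _ _ _ `[0, T]).
    by apply: subset_itv; rewrite bnd_simp// ge_min lexx.
  move=> t; apply: cvg_norm; apply: cvgB; last exact: cvg_cst.
  by apply: cvgB; apply: (cOmega_line_t c0); apply/andP; split; lra.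
have Tr : 0 < Num.min T r by rewrite lt_min T0 r0.
apply: (le_closure_itv Tr cg); last by rewrite lexx ltW.
move=> t /andP[t0]; rewrite lt_min => /andP[tT tr].
have := @MVT_dist2 eps M x (h + x) (fun y => q 0%N 0%N (y, t)) (fun y => q 1%N 0%N (y, t))
  (q 1%N 0%N (x, 0)) e.
rewrite addrK; apply.
- by rewrite ex xM.
- by [].
- by apply: (cOmega_line_x c0); rewrite !ltW.
- move=> y /[!in_itv]/= yem; case: Hq => _ _ /(_ 0%N 0%N isT (y, t)) [] //=.
  by split => //=; rewrite t0.
- move=> z /andP[ez zM] zx; apply: rq.
    split; rewrite /ball/=; first by rewrite distrC (le_lt_trans zx).
    by rewrite sub0r normrN gtr0_norm.
  by split => /=; apply/andP; split; lra.
Qed.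

End Jets.

(** * Linear structure of H^5 and uniqueness of the data *)

(** Linear combinations of jets; a scaling is written [comb s h 0 h]. *)
Definition comb (R : realType) (a : R) (q : jet R) (b : R) (h : jet R) : jet R :=
  fun i j p => a * q i j p + b * h i j p.

Lemma comb_sub (R : realType) (q h : jet R) : q - h = comb 1 q (-1) h.
Proof.
apply/funext => i; apply/funext => j; apply/funext => p.
by rewrite /comb mul1r mulN1r.
Qed.

Definition jet_sqint (R : realType) (k : nat) (U : set (plane R)) (q : jet R) :=
  forall i j : nat, (i + j <= k)%N -> square_integrable U (q i j).

Section SobDot.
Context (R : realType) (k : nat) (U : set (plane R)).
Hypothesis mU : measurable U.
Implicit Types q h g : jet R.

Lemma jet_sqint_comb a q b h : jet_sqint k U q -> jet_sqint k U h ->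
  jet_sqint k U (comb a q b h).
Proof.
by move=> sq sh i j ij; apply: sqintD => //; apply: sqintZ => //; [exact: sq|exact: sh].
Qed.

Lemma sob_dotC q h : sob_dot k U q h = sob_dot k U h q.
Proof.
apply: eq_bigr => i _; apply: eq_bigr => j _; apply: eq_Rintegral => p _.
by rewrite mulrC.
Qed.

Lemma Rintegral_comb (a b : R) (f1 f2 g : plane R -> R) :
  square_integrable U f1 -> square_integrable U f2 -> square_integrable U g ->
  \int[leb2 R]_(p in U) ((a * f1 p + b * f2 p) * g p) =
  a * \int[leb2 R]_(p in U) (f1 p * g p) + b * \int[leb2 R]_(p in U) (f2 p * g p).
Proof.
move=> s1 s2 sg.
have i1 := sqint_mul_integrable mU s1 sg; have i2 := sqint_mul_integrable mU s2 sg.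
rewrite -(RintegralZl a mU i1) -(RintegralZl b mU i2).
rewrite -(RintegralD mU (integrableZl mU a i1) (integrableZl mU b i2)).
by apply: eq_Rintegral => p _; rewrite mulrDl !mulrA.
Qed.

Lemma sob_dot_combl a q b h g :
  jet_sqint k U q -> jet_sqint k U h -> jet_sqint k U g ->
  sob_dot k U (comb a q b h) g = a * sob_dot k U q g + b * sob_dot k U h g.
Proof.
move=> sq sh sg; rewrite /sob_dot !mulr_sumr -big_split; apply: eq_bigr => i _.
rewrite !mulr_sumr -big_split; apply: eq_bigr => j ij.
by apply: Rintegral_comb; [exact: sq|exact: sh|exact: sg].
Qed.

Lemma sob_dot_combr a q b h g :
  jet_sqint k U q -> jet_sqint k U h -> jet_sqint k U g ->
  sob_dot k U g (comb a q b h) = a * sob_dot k U g q + b * sob_dot k U g h.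
Proof. by move=> sq sh sg; rewrite sob_dotC sob_dot_combl// !(sob_dotC _ g). Qed.

Lemma sob_dot_comb2 a q b h : jet_sqint k U q -> jet_sqint k U h ->
  sob_dot k U (comb a q b h) (comb a q b h) =
  a ^+ 2 * sob_dot k U q q + 2 * a * b * sob_dot k U q h + b ^+ 2 * sob_dot k U h h.
Proof.
move=> sq sh; have sc := jet_sqint_comb a b sq sh.
by rewrite sob_dot_combl// !sob_dot_combr// (sob_dotC h q); ring.
Qed.

(** The parallelogram law, with the square of the other combination dropped. *)
Lemma sob_dot_comb_le a q b h : jet_sqint k U q -> jet_sqint k U h ->
  sob_dot k U (comb a q b h) (comb a q b h) <=
  2 * a ^+ 2 * sob_dot k U q q + 2 * b ^+ 2 * sob_dot k U h h.
Proof.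
move=> sq sh; have := sob_dot_ge0 k U (comb a q (- b) h).
by rewrite !sob_dot_comb2//; nra.
Qed.

(** The defect of convexity of the squared norm is s (1 - s) times the squared
    norm of the difference. *)
Lemma sob_dot_convex s q h : jet_sqint k U q -> jet_sqint k U h -> 0 <= s <= 1 ->
  sob_dot k U (comb (1 - s) q s h) (comb (1 - s) q s h) <=
  (1 - s) * sob_dot k U q q + s * sob_dot k U h h.
Proof.
move=> sq sh /andP[s0 s1]; have := sob_dot_ge0 k U (comb 1 q (-1) h).
rewrite !sob_dot_comb2// => D0.
have : 0 <= s * (1 - s) * (1 ^+ 2 * sob_dot k U q q +
  2 * 1 * -1 * sob_dot k U q h + (-1) ^+ 2 * sob_dot k U h h).
  by rewrite mulr_ge0// mulr_ge0// subr_ge0.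
by lra.
Qed.

End SobDot.

Section H5Linear.
Context (R : realType).
Variables (eps M T : R).
Hypotheses (epsM : eps < M) (T0 : 0 < T).
Notation Om := (Omega eps M T).
Notation cOm := (cOmega eps M T).
Implicit Types (q h : jet R).

Lemma H5_jet_sqint q : H5 eps M T q -> jet_sqint 5 Om q.
Proof. by move=> Hq i j ij; exact: H5_sqint. Qed.

Lemma compact_cOmega : compact cOm.
Proof.
have -> : cOm = `[eps, M] `*` `[0, T].
  by apply/seteqP; split => -[x t] /=; rewrite !in_itv.
by apply: compact_setX; exact: segment_compact.
Qed.

Lemma continuous_bounded_Omega (f : R * R -> R) : {within cOm, continuous f} ->
  exists K : R, forall p, cOm p -> `|f p| <= K.
Proof.
move=> cf; have /compact_bounded[K [_ Kf]] := continuous_compact cf compact_cOmega.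
by exists (K + 1) => p cp; apply: (Kf (K + 1)); [rewrite ltrDl|exists p].
Qed.

Lemma Omega_cOmega : Om `<=` cOm.
Proof.
by move=> [x t] [/= /andP[? ?] /andP[? ?]]; split => /=; rewrite !ltW.
Qed.

Lemma continuous_sqint (f : plane R -> R) :
  measurable_fun (Om : set (plane R)) f ->
  {within cOm, continuous f} -> square_integrable Om f.
Proof.
move=> mf /continuous_bounded_Omega[K fK].
apply: (@sqint_bounded _ _ _ K) => //; first exact: measurable_Omega.
- exact: leb2_Omega_fin.
- by move=> p /Omega_cOmega; exact: fK.
Qed.

Lemma test_sqint U phi i j : test_function U phi -> square_integrable Om (pd i j phi).
Proof.
move=> [sphi _]; have [c _] := sphi i j.
apply: continuous_sqint; last exact: continuous_subspaceT.
apply: measurable_funTS; exact: continuous_measurable2.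
Qed.

Lemma weak_derivative_comb i j a b (f w g z : plane R -> R) :
  square_integrable Om f -> square_integrable Om w ->
  square_integrable Om g -> square_integrable Om z ->
  weak_derivative Om i j f w -> weak_derivative Om i j g z ->
  weak_derivative Om i j (fun p => a * f p + b * g p) (fun p => a * w p + b * z p).
Proof.
move=> sf sw sg sz fw gz phi tphi; have m := measurable_Omega eps M T.
have s1 := test_sqint i j tphi; have s2 := test_sqint 0%N 0%N tphi.
rewrite (Rintegral_comb m a b sf sg s1) (Rintegral_comb m a b sw sz s2).
by rewrite (fw _ tphi) (gz _ tphi) mulrDr !mulrA ![_ * (-1) ^+ _]mulrC.
Qed.

Lemma H5_comb a q b h : H5 eps M T q -> H5 eps M T h -> H5 eps M T (comb a q b h).
Proof.
move=> Hq Hh; have sq := H5_jet_sqint Hq; have sh := H5_jet_sqint Hh.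
have [wq cq dq] := Hq; have [wh ch dh] := Hh; split.
- move=> i j ij; split.
    by apply: (jet_sqint_comb _ a b sq sh) => //; exact: measurable_Omega.
  have [_ wqij] := wq _ _ ij; have [_ whij] := wh _ _ ij.
  by apply: weak_derivative_comb => //; [exact: sq|exact: sq|exact: sh|exact: sh].
- move=> i j ij p; apply: cvgD; apply: cvgM.
  + exact: cvg_cst.
  + exact: cq.
  + exact: cvg_cst.
  + exact: ch.
- move=> i j ij p Op; have [dq1 dq2] := dq _ _ ij _ Op; have [dh1 dh2] := dh _ _ ij _ Op.
  by split; apply: is_derive_eq.
Qed.

Lemma norm5_le q r : 0 <= r -> (norm5 eps M T q <= r) = (dot5 eps M T q q <= r ^+ 2).
Proof.
move=> r0; have <- : norm5 eps M T q ^+ 2 = dot5 eps M T q q by exact: sob_norm_sqr.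
rewrite ler_pXn2r//.
by rewrite nnegrE /sob_norm sqrtr_ge0.
Qed.

(** The points of the interval other than s accumulate at s, also when s is an
    end point.  Two admissible functions thus share the derivative of g0, which
    makes the condition on q_x affine. *)
Lemma deriv_on_unique (a b : R) (g : R -> R) s d d' : a < b -> a <= s <= b ->
  deriv_on a b g s d -> deriv_on a b g s d' -> d = d'.
Proof.
move=> ab /andP[as_ sb] gd gd'; apply/eqP/negPn/negP => dd'.
have e0 : 0 < `|d - d'| / 2 by rewrite divr_gt0// normr_gt0 subr_eq0.
move/cvgrPdist_lt : gd => /(_ _ e0) gd; move/cvgrPdist_lt : gd' => /(_ _ e0) gd'.
rewrite near_withinE /dnbhs near_withinE in gd.
rewrite near_withinE /dnbhs near_withinE in gd'.
move/nbhs_ballP : gd => [r1 /= r10 H1]; move/nbhs_ballP : gd' => [r2 /= r20 H2].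
pose r := Num.min r1 r2; have r0 : 0 < r by rewrite lt_min r10.
have [y [ys rys yab]] : exists y, [/\ y != s, `|s - y| < r & y \in `[a, b]].
  have [sb'|bs] := ltP s b.
    pose m := Num.min r (b - s); have m0 : 0 < m by rewrite lt_min r0 subr_gt0.
    have mr : m <= r by rewrite /m ge_min lexx.
  have mb : m <= b - s by rewrite /m ge_min lexx orbT.
    exists (s + m / 2); split.
    - by rewrite gt_eqF// ltrDl divr_gt0.
    - have -> : s - (s + m / 2) = - (m / 2) by ring.
      by rewrite normrN gtr0_norm ?divr_gt0//; lra.
    - by rewrite in_itv/=; apply/andP; split; lra.
  pose m := Num.min r (b - a); have m0 : 0 < m by rewrite lt_min r0 subr_gt0.
  have mr : m <= r by rewrite /m ge_min lexx.
  have mb : m <= b - a by rewrite /m ge_min lexx orbT.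
  exists (s - m / 2); split.
  - by rewrite lt_eqF// gtrDl oppr_lt0 divr_gt0.
  - have -> : s - (s - m / 2) = m / 2 by ring.
    by rewrite gtr0_norm ?divr_gt0//; lra.
  - by rewrite in_itv/=; apply/andP; split; lra.
move: rys; rewrite lt_min => /andP[rys1 rys2].
have h1 := H1 y rys1 ys yab; have h2 := H2 y rys2 ys yab.
set z := _ / _ in h1 h2.
have : `|d - d'| <= `|d - z| + `|d' - z| by rewrite (distrC d' z) ler_distD.
by lra.
Qed.

End H5Linear.

(** * Polynomials in x belong to H^5 *)

Section Parts.
Context (R : realType).
Variables (eps M T : R).
Hypotheses (epsM : eps < M) (T0 : 0 < T).
Notation Om := (Omega eps M T).
Notation cOm := (cOmega eps M T).
Implicit Types (F DF f : R * R -> R).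

Lemma plane_continuous_sqint F : continuous F -> square_integrable Om F.
Proof.
move=> cF; apply: continuous_sqint; last exact: continuous_subspaceT.
by apply: measurable_funTS; exact: continuous_measurable2.
Qed.

Lemma plane_continuous_integrable F : continuous F ->
  (leb2 R).-integrable Om (EFin \o F).
Proof.
move=> cF; have s1 : square_integrable Om (cst 1 : R * R -> R).
  by apply: plane_continuous_sqint; exact: cst_continuous.
have := sqint_mul_integrable (measurable_Omega eps M T) (plane_continuous_sqint cF) s1.
by apply: eq_integrable; [exact: measurable_Omega|move=> p _ /=; rewrite mulr1].
Qed.

Lemma integral_line_zero (a b : R) (F DF : R -> R) : a < b ->
  continuous F -> continuous DF -> (forall x : R, is_derive x 1 F (DF x)) ->
  F a = 0 -> F b = 0 ->
  (\int[@lebesgue_measure R]_(x in `]a, b[) (DF x)%:E = 0)%E.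
Proof.
move=> ab cF cDF dF Fa Fb.
have wF : {within `[a, b], continuous F} by exact: continuous_subspaceT.
have wDF : {within `[a, b], continuous DF} by exact: continuous_subspaceT.
have E : \int[@lebesgue_measure R]_(x in `]a, b[) DF x = 0.
  by rewrite Rintegral_itv_oo_cc// (FTC_within ab wF wDF)// Fa Fb subrr.
have i := within_itv_integrable_oo wDF.
rewrite -[LHS]fineK; last exact: integrable_fin_num.
by congr (_%:E).
Qed.

Lemma continuous_line_x F (t : R) : continuous F -> continuous (fun x : R => F (x, t)).
Proof.
move=> cF x; apply: (@continuous_comp _ _ _ (fun x : R => (x, t)) F); last exact: cF.
apply/cvg_ballP => e e0; apply/nbhs_ballP; exists e => //= y xy.
by split => //=; exact: ballxx.
Qed.

Lemma continuous_line_t F (x : R) : continuous F -> continuous (fun t : R => F (x, t)).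
Proof.
move=> cF t; apply: (@continuous_comp _ _ _ (fun t : R => (x, t)) F); last exact: cF.
apply/cvg_ballP => e e0; apply/nbhs_ballP; exists e => //= y xy.
by split => //=; exact: ballxx.
Qed.

(** The integral of an x-derivative over the rectangle vanishes line by line. *)
Lemma Rintegral_dx_zero F DF : continuous F -> continuous DF ->
  (forall p : R * R, is_derive p.1 1 (fun x : R => F (x, p.2)) (DF p)) ->
  (forall p, ~ Om p -> F p = 0) -> \int[leb2 R]_(p in Om) DF p = 0.
Proof.
move=> cF cDF dF F0; rewrite /Rintegral integral_mkcond.
have /integrable_restrict : (leb2 R).-integrable (setT `&` Om) (EFin \o DF).
  by rewrite setTI; exact: plane_continuous_integrable.
move=> /(_ (measurable_Omega eps M T) measurableT) i.
have := integral21_prod_meas1 i; rewrite -/(leb2 R) => <-.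
rewrite (_ : fubini_G _ _ = cst 0%E) ?integral0//; apply/funext => t.
rewrite /fubini_G; under eq_integral do rewrite patch_lines.
have [/[!in_itv]/= tT|tT] := boolP (t \in `]0, T[); last first.
  by under eq_integral do rewrite if_same; rewrite integral0.
transitivity (\int[@lebesgue_measure R]_(x in `]eps, M[) (DF (x, t))%:E)%E.
  rewrite [RHS]integral_mkcond; apply: eq_integral => x _.
  by rewrite patchE mem_setE; case: ifP.
apply: (@integral_line_zero _ _ (fun x : R => F (x, t))) => //.
- exact: continuous_line_x.
- exact: continuous_line_x.
- by move=> x; exact: (dF (x, t)).
- by apply: F0 => -[/=]; rewrite ltxx.
- by apply: F0 => -[/=]; rewrite ltxx andbF.
Qed.

Lemma Rintegral_dt_zero F DF : continuous F -> continuous DF ->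
  (forall p : R * R, is_derive p.2 1 (fun t : R => F (p.1, t)) (DF p)) ->
  (forall p, ~ Om p -> F p = 0) -> \int[leb2 R]_(p in Om) DF p = 0.
Proof.
move=> cF cDF dF F0; rewrite /Rintegral integral_mkcond.
have /integrable_restrict : (leb2 R).-integrable (setT `&` Om) (EFin \o DF).
  by rewrite setTI; exact: plane_continuous_integrable.
move=> /(_ (measurable_Omega eps M T) measurableT) i.
have := integral12_prod_meas1 i; rewrite -/(leb2 R) => <-.
rewrite (_ : fubini_F _ _ = cst 0%E) ?integral0//; apply/funext => x.
rewrite /fubini_F; under eq_integral do rewrite patch_lines.
have [xM|xM] := boolP (x \in `]eps, M[); last by rewrite integral0.
transitivity (\int[@lebesgue_measure R]_(t in `]0%R, T[) (DF (x, t))%:E)%E.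
  rewrite [RHS]integral_mkcond; apply: eq_integral => t _.
  by rewrite patchE mem_setE; case: ifP.
apply: (@integral_line_zero _ _ (fun t : R => F (x, t))) => //.
- exact: continuous_line_t.
- exact: continuous_line_t.
- by move=> t; exact: (dF (x, t)).
- by apply: F0 => -[/= _]; rewrite ltxx.
- by apply: F0 => -[/= _]; rewrite ltxx andbF.
Qed.

Lemma derive1_near0 (f : R -> R) (x : R) : (\forall y \near x, f y = 0) ->
  derive1 f x = 0.
Proof.
move=> f0; rewrite derive1E (@near_eq_derive _ _ _ f (cst 0)) ?derive_cst//.
Qed.

(** A function that vanishes near a point has zero derivatives there. *)
Lemma pd_support (K : set (R * R)) (phi : R * R -> R) i j : closed K ->
  (forall p, ~ K p -> phi p = 0) -> forall p, ~ K p -> pd i j phi p = 0.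
Proof.
move=> cK phi0; have oK : open (~` K) by exact: closed_openC.
have t0 : forall p, ~ K p -> iter j (@pdt R) phi p = 0.
  elim: j => //= j IH [x t] Kp; apply: derive1_near0 => /=.
  have /nbhs_ballP[r /= r0 rK] : nbhs (x, t) (~` K) by exact: open_nbhs_nbhs.
  apply/nbhs_ballP; exists r => //= s ts; apply: IH; apply: rK.
  by split => //=; exact: ballxx.
rewrite /pd; elim: i => //= i IH [x t] Kp; apply: derive1_near0 => /=.
have /nbhs_ballP[r /= r0 rK] : nbhs (x, t) (~` K) by exact: open_nbhs_nbhs.
apply/nbhs_ballP; exists r => //= s ts; apply: IH; apply: rK.
by split => //=; exact: ballxx.
Qed.

Lemma test_pd_Omega phi i j : test_function Om phi ->
  forall p, ~ Om p -> pd i j phi p = 0.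
Proof.
move=> [_ [K [cK KO phi0]]] p Op; apply: (@pd_support K) => //.
  by apply: compact_closed cK; exact: norm_hausdorff.
by move=> /KO.
Qed.

Lemma continuous_poly_fst (g : {poly R}) : continuous (fun p : R * R => g.[p.1]).
Proof.
move=> p; apply: (@continuous_comp _ _ _ fst (horner g)); first exact: cvg_fst.
exact: continuous_horner.
Qed.

Lemma poly_parts_x (g : {poly R}) phi i j : test_function Om phi ->
  \int[leb2 R]_(p in Om) (g.[p.1] * pd i.+1 j phi p) =
  - \int[leb2 R]_(p in Om) (g^`().[p.1] * pd i j phi p).
Proof.
move=> tphi; have [sphi _] := tphi; have [c d] := sphi i j.
have [c' _] := sphi i.+1 j.
have mO := measurable_Omega eps M T.
have i1 := sqint_mul_integrable mO (plane_continuous_sqint (@continuous_poly_fst g))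
  (plane_continuous_sqint c').
have i2 := sqint_mul_integrable mO (plane_continuous_sqint (@continuous_poly_fst g^`()))
  (plane_continuous_sqint c).
apply/eqP; rewrite -addr_eq0; apply/eqP; rewrite -(RintegralD mO i1 i2).
apply: (@Rintegral_dx_zero (fun p => g.[p.1] * pd i j phi p)).
- by move=> p; apply: cvgM; [exact: continuous_poly_fst|exact: c].
- move=> p; apply: cvgD; apply: cvgM;
    by [exact: continuous_poly_fst|exact: c'|exact: c].
- move=> p; have [dx _] := d p.
  have dphi : is_derive p.1 1 (fun x : R => pd i j phi (x, p.2)) (pd i.+1 j phi p).
    by apply: DeriveDef => //; rewrite -derive1E.
  have dg : is_derive p.1 1 (fun x : R => g.[x]) g^`().[p.1] by exact: is_derive_poly.
  by apply: is_derive_eq; rewrite /GRing.scale/=; case: p {dx dphi dg} => x t /=; ring.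
- by move=> p Op; rewrite (test_pd_Omega _ _ tphi Op) mulr0.
Qed.

Lemma poly_parts_t (g : {poly R}) phi j : test_function Om phi ->
  \int[leb2 R]_(p in Om) (g.[p.1] * pd 0 j.+1 phi p) = 0.
Proof.
move=> tphi; have [sphi _] := tphi; have [c d] := sphi 0%N j.
have [c' _] := sphi 0%N j.+1.
apply: (@Rintegral_dt_zero (fun p => g.[p.1] * pd 0 j phi p)).
- by move=> p; apply: cvgM; [exact: continuous_poly_fst|exact: c].
- by move=> p; apply: cvgM; [exact: continuous_poly_fst|exact: c'].
- move=> p; have [_ dt] := d p.
  have dphi : is_derive p.2 1 (fun t : R => pd 0 j phi (p.1, t)) (pd 0 j.+1 phi p).
    by apply: DeriveDef => //; rewrite -derive1E.
  have dg : is_derive p.2 1 (fun t : R => g.[p.1]) 0 by exact: is_derive_cst.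
  rewrite /=; apply: is_derive_eq; rewrite /GRing.scale/=.
  by case: p {dt dphi dg} => x t /=; ring.
- by move=> p Op; rewrite (test_pd_Omega _ _ tphi Op) mulr0.
Qed.

(** A polynomial in x, with its derivatives: those involving t vanish. *)
Definition poly_jet (g : {poly R}) : jet R :=
  fun i j p => if j is 0%N then (g^`(i)).[p.1] else 0.

(** The order of [pd] puts the x-derivatives outermost, so they are removed one
    by one, without exchanging derivatives of the test function. *)
Lemma poly_parts (g : {poly R}) phi i j : test_function Om phi ->
  \int[leb2 R]_(p in Om) (g.[p.1] * pd i j phi p) =
  (-1) ^+ i * \int[leb2 R]_(p in Om) (g^`(i).[p.1] * pd 0 j phi p).
Proof.
move=> tphi; elim: i g => [|i IH] g; first by rewrite expr0 mul1r derivn0.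
by rewrite poly_parts_x// IH derivSn exprS -mulrA mulN1r.
Qed.

Lemma continuous_poly_jet (g : {poly R}) i j : continuous (poly_jet g i j).
Proof.
case: j => [|j]; first exact: continuous_poly_fst.
by move=> p; exact: cvg_cst.
Qed.

Lemma H5_poly_jet (g : {poly R}) : H5 eps M T (poly_jet g).
Proof.
split.
- move=> i j _; split; first by apply: plane_continuous_sqint; exact: continuous_poly_jet.
  move=> phi tphi; rewrite /poly_jet derivn0 poly_parts//.
  case: j => [|j]; first by rewrite addn0.
  rewrite poly_parts_t// mulr0.
  under eq_Rintegral do rewrite mul0r.
  by rewrite /Rintegral integral0 mulr0.
- by move=> i j _; apply: continuous_subspaceT; exact: continuous_poly_jet.
- move=> i [|j] _ p _; rewrite /poly_jet; split => /=; last exact: is_derive_cst.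
  + exact: is_derive_poly.
  + exact: is_derive_cst.
  + exact: is_derive_cst.
Qed.

End Parts.

(** * The competitor built from the exact solution *)

Section Admissible.
Context (R : realType).
Variables (eps M T cup : R).
Hypotheses (epsM : eps < M) (T0 : 0 < T) (cup1 : 1 < cup).
Notation Om := (Omega eps M T).
Notation cOm := (cOmega eps M T).
Notation S := (sobolev_const eps M T).
Implicit Types (q h : jet R).

Lemma qlow_gt0 : 0 < qlow cup.
Proof. by rewrite /qlow invr_gt0 mulr_gt0// powR_gt0// (lt_trans ltr01). Qed.

Lemma qlow_lt : qlow cup < 2^-1.
Proof.
have c0 : 0 < cup := lt_trans ltr01 cup1.
rewrite /qlow ltf_pV2 ?posrE ?mulr_gt0 ?powR_gt0// ltr_pMr//.
have : 1 `^ 4^-1 < cup `^ 4^-1 by apply: gt0_ltr_powR; rewrite ?nnegrE ?invr_gt0// ltW.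
by rewrite powR1.
Qed.

Lemma coef_of_eq1 q x : 0 < q 0%N 0%N (x, 0) -> coef_of q x = 1 ->
  q 0%N 0%N (x, 0) = 2^-1.
Proof.
rewrite /coef_of; set a := q _ _ _ => a0 /(congr1 GRing.inv).
rewrite invrK invr1 => a4.
have : (a ^+ 2 - 4^-1) * (a ^+ 2 + 4^-1) = 0 by lra.
move=> /eqP; rewrite mulf_eq0 => /orP[/eqP a2|/eqP a2]; last by have := sqr_ge0 a; lra.
have : (a - 2^-1) * (a + 2^-1) = 0 by lra.
by move=> /eqP; rewrite mulf_eq0 => /orP[/eqP|/eqP]; lra.
Qed.

(** Continuity carries the value 1, taken outside the interval, to its end points. *)
Lemma coefficient_boundary (clow : R) (c : R -> R) : coefficient eps M clow cup c ->
  c eps = 1 /\ c M = 1.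
Proof.
move=> [dc _ c1 _].
have cc x : c @ x --> c x.
  by apply/differentiable_continuous/derivable1_diffP; exact: (dc 0%N).
have left : \forall y \near eps^'-, c y = 1.
  apply: filterS (nbhs_left_lt eps) => y ye; apply: c1.
  by rewrite leNgt ye.
have right : \forall y \near M^'+, c y = 1.
  apply: filterS (nbhs_right_gt M) => y yM; apply: c1.
  by rewrite [y <= M]leNgt yM andbF.
have cl := cvg_at_left_filter (cc eps); have cr := cvg_at_right_filter (cc M).
split; apply/le_anti/andP; split.
- by apply: cvgr_to_le cl _; apply: filterS left => y ->.
- by apply: cvgr_to_ge cl _; apply: filterS left => y ->.
- by apply: cvgr_to_le cr _; apply: filterS right => y ->.
- by apply: cvgr_to_ge cr _; apply: filterS right => y ->.
Qed.

Lemma trace_lipschitz q (L x y : R) : H5 eps M T q -> 0 <= L ->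
  S * dot5 eps M T q q <= L ^+ 2 ->
  eps <= x -> x < y -> y <= M ->
  `|q 0%N 0%N (y, 0) - q 0%N 0%N (x, 0)| <= L * (y - x).
Proof.
move=> Hq L0 qL ex xy yM.
have T00 : 0 <= (0 : R) <= T by rewrite lexx ltW.
have cq : {within `[x, y], continuous (fun x => q 0%N 0%N (x, 0))}.
  apply: (@continuous_subspaceW _ _ _ `[eps, M]).
    by apply: subset_itv; rewrite bnd_simp.
  by apply: (cOmega_line_x _ T00); exact: (H5_cont Hq).
have dq z : z \in `]x, y[ -> is_derive z 1 (fun x : R => q 0%N 0%N (x, 0))
    (q 1%N 0%N (z, 0)).
  move=> /[!in_itv]/= /andP[xz zy]; apply: (is_derive_trace0 T0 Hq).
  by rewrite (le_lt_trans ex xz) (lt_le_trans zy yM).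
have Dq z : x < z < y -> `|0 - q 1%N 0%N (z, 0)| <= L.
  move=> /andP[xz zy]; rewrite sub0r normrN.
  have cz : cOm (z, 0).
    by split => //=; rewrite (ltW (le_lt_trans ex xz)) (ltW (lt_le_trans zy yM)).
  have := le_trans (H5_sup_bound epsM T0 Hq (leqnn 1) cz) qL.
  by rewrite -[q _ _ _ ^+ 2]real_normK ?num_real// ler_pXn2r ?nnegrE.
by have := MVT_dist xy cq dq Dq; rewrite mul0r subr0.
Qed.

(** Double zeros at both ends: neither q(eps,t), q_x(eps,t) nor q_x(M,t) changes
    when a multiple of this polynomial is added. *)
Definition bump_poly : {poly R} := ('X - eps%:P) ^+ 2 * ('X - M%:P) ^+ 2.

Definition bump : jet R := poly_jet bump_poly.

Lemma bumpE x t : bump 0%N 0%N (x, t) = (x - eps) ^+ 2 * (x - M) ^+ 2.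
Proof. by rewrite /bump /poly_jet derivn0 /bump_poly !hornerE. Qed.

Lemma bump_deriv x t : bump 1%N 0%N (x, t) =
  2 * (x - eps) * (x - M) ^+ 2 + 2 * (x - eps) ^+ 2 * (x - M).
Proof.
rewrite /bump /poly_jet derivn1 /bump_poly derivM !expr2 !derivM !derivB !derivX !derivC.
rewrite !subr0 !mul1r !mulr1 /= !(hornerD, hornerN, hornerM, hornerX, hornerC).
by ring.
Qed.

Lemma H5_bump : H5 eps M T bump.
Proof. exact: H5_poly_jet. Qed.

(** The first summand replaces the exact data by the noisy ones; the second
    restores the constraint q(x,0) >= qlow. *)
Definition correction (Gd Gs : jet R) (A delta : R) : jet R :=
  comb 1 (comb 1 Gd (-1) Gs) (A * delta) bump.

Definition competitor (qs Gd Gs : jet R) (A delta : R) : jet R :=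
  comb 1 qs 1 (correction Gd Gs A delta).

Lemma H5_correction Gd Gs A delta : H5 eps M T Gd -> H5 eps M T Gs ->
  H5 eps M T (correction Gd Gs A delta).
Proof. by move=> Hd Hs; do ?apply: H5_comb => //; exact: H5_bump. Qed.

Definition correction_const (A : R) : R := 2 + 2 * A ^+ 2 * dot5 eps M T bump bump.

Lemma dot5_ge0 q : 0 <= dot5 eps M T q q.
Proof. exact: sob_dot_ge0. Qed.

Lemma correction_const_gt0 A : 0 < correction_const A.
Proof. by rewrite ltr_pwDl// mulr_ge0 ?dot5_ge0// mulr_ge0 ?sqr_ge0. Qed.

Lemma dot5_correction Gd Gs A delta : H5 eps M T Gd -> H5 eps M T Gs -> 0 < delta ->
  norm5 eps M T (Gd - Gs) < delta ->
  dot5 eps M T (correction Gd Gs A delta) (correction Gd Gs A delta)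
    <= correction_const A * delta ^+ 2.
Proof.
move=> Hd Hs d0; rewrite comb_sub => /ltW; rewrite norm5_le; last exact: ltW.
  move=> Gn.
have sG : jet_sqint 5 Om (comb 1 Gd (-1) Gs).
  by apply: H5_jet_sqint; apply: H5_comb.
have := sob_dot_comb_le (measurable_Omega eps M T) 1 (A * delta) sG (H5_jet_sqint H5_bump).
move/le_trans; apply; rewrite -!/(dot5 _ _ _ _ _) /correction_const.
by rewrite exprMn; lra.
Qed.

(** Distance of the end point values q(eps,0) = q(M,0) = 1/2 to the obstacle. *)
Definition gap : R := 2^-1 - qlow cup.

Lemma gap_gt0 : 0 < gap.
Proof. by rewrite subr_gt0 qlow_lt. Qed.

(** If the slope of q(.,0) is at most [L], then q(.,0) stays [gap / 2] above the
    obstacle within distance eta = gap / (2 L) of the end points; further inside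
    the bump is at least eta^4.  This weight makes the bump compensate the error
    [Num.sqrt sobolev_const * delta] there. *)
Definition bump_weight (L : R) : R := Num.sqrt S / (gap / (2 * L)) ^+ 4.

(** Near the end points the distance to the obstacle absorbs the error of the
    data; elsewhere the bump does. *)
Lemma competitor_ge_qlow qs Gd Gs (L delta x : R) :
  H5 eps M T qs -> H5 eps M T Gd -> H5 eps M T Gs ->
  0 < L -> S * dot5 eps M T qs qs <= L ^+ 2 ->
  qs 0%N 0%N (eps, 0) = 2^-1 -> qs 0%N 0%N (M, 0) = 2^-1 ->
  (forall x, eps <= x <= M -> qlow cup <= qs 0%N 0%N (x, 0)) ->
  0 < delta -> norm5 eps M T (Gd - Gs) < delta ->
  Num.sqrt S * delta <= gap / 2 ->
  eps <= x <= M ->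
  qlow cup <= competitor qs Gd Gs (bump_weight L) delta 0%N 0%N (x, 0).
Proof.
move=> Hqs Hd Hs L0 qL qe qM qlo d0 Gn kd xeM.
have S0 : 0 <= S by rewrite ltW// sobolev_const_gt0.
rewrite /competitor /correction {1 2 3}/comb bumpE !mul1r mulN1r.
set w := Gd 0%N 0%N _ - Gs 0%N 0%N _.
have wk : `|w| <= Num.sqrt S * delta.
  have cx : cOm (x, 0) by split => //=; rewrite lexx ltW.
  move: Gn; rewrite comb_sub => /ltW; rewrite norm5_le; last exact: ltW.
  move=> Gn.
  have := H5_sup_bound epsM T0 (H5_comb 1 (-1) Hd Hs) (leq0n 1) cx.
  rewrite /comb mul1r mulN1r -/w => /le_trans - /(_ _ (ler_wpM2l S0 Gn)).
  rewrite -[X in X * _](sqr_sqrtr S0) -exprMn -[w ^+ 2]real_normK ?num_real//.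
  by rewrite ler_pXn2r// nnegrE ?normr_ge0// mulr_ge0 ?sqrtr_ge0 ?ltW.
have wl : - (Num.sqrt S * delta) <= w by rewrite lerNl (le_trans _ wk)// -normrN ler_norm.
have g0 := gap_gt0.
(* Within eta of an end point, qs decreases by at most gap / 2. *)
pose eta := gap / (2 * L); have e0 : 0 < eta by rewrite divr_gt0// mulr_gt0.
have Le : L * eta = gap / 2 by rewrite /eta; field; rewrite gt_eqF.
have W0 : 0 <= bump_weight L.
  by rewrite /bump_weight divr_ge0 ?sqrtr_ge0// exprn_ge0// ltW.
have B0 : 0 <= bump_weight L * delta * ((x - eps) ^+ 2 * (x - M) ^+ 2).
  by apply: mulr_ge0; [exact: mulr_ge0 (ltW d0)|apply: mulr_ge0; exact: sqr_ge0].
(* y is an end point, where qs equals 1/2. *)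
have near_end y z : eps <= y -> y <= M -> eps <= z -> z <= M -> `|y - z| <= eta ->
    qs 0%N 0%N (y, 0) = 2^-1 -> qlow cup + gap / 2 <= qs 0%N 0%N (z, 0).
  move=> ey yM ez zM yz qy.
  suff : `|qs 0%N 0%N (z, 0) - qs 0%N 0%N (y, 0)| <= gap / 2.
    by rewrite ler_norml qy /gap => /andP[]; lra.
  rewrite -Le; have [yz'|zy|->] := ltgtP y z; last by rewrite subrr normr0 mulr_ge0 ?ltW.
    apply: le_trans (trace_lipschitz Hqs (ltW L0) qL ey yz' zM) _.
    rewrite ler_pM2l//; apply: le_trans yz; rewrite distrC; exact: ler_norm.
  rewrite distrC; apply: le_trans (trace_lipschitz Hqs (ltW L0) qL ez zy yM) _.
  rewrite ler_pM2l//; apply: le_trans yz; exact: ler_norm.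
case/andP: (xeM) => ex xM.
have [xe|xe] := leP (x - eps) eta.
  have := near_end eps x (lexx _) (ltW epsM) ex xM _ qe.
  rewrite distrC ger0_norm ?subr_ge0// => /(_ xe); lra.
have [Mx|Mx] := leP (M - x) eta.
  have := near_end M x (ltW epsM) (lexx _) ex xM _ qM.
  rewrite ger0_norm ?subr_ge0// => /(_ Mx); lra.
have := qlo _ xeM.
suff : Num.sqrt S * delta <= bump_weight L * delta * ((x - eps) ^+ 2 * (x - M) ^+ 2) by lra.
have E : eta ^+ 4 <= (x - eps) ^+ 2 * (x - M) ^+ 2.
  have -> : eta ^+ 4 = eta ^+ 2 * eta ^+ 2 by rewrite -exprD.
  apply: ler_pM; rewrite ?sqr_ge0//.
    by rewrite ler_pXn2r ?nnegrE ?ltW// (lt_trans e0).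
  have -> : (x - M) ^+ 2 = (M - x) ^+ 2 by ring.
  by rewrite ler_pXn2r ?nnegrE ?ltW// (lt_trans e0).
move: E; set P := (x - eps) ^+ 2 * _ => E.
have -> : bump_weight L * delta * P = Num.sqrt S * delta * (P / eta ^+ 4).
  by rewrite /bump_weight -/eta; ring.
rewrite -[leLHS]mulr1; apply: ler_wpM2l; first by rewrite mulr_ge0 ?sqrtr_ge0// ltW.
by rewrite ler_pdivlMr ?exprn_gt0// mul1r.
Qed.

Lemma competitor_admissible g0s g1s g0d g1d qs Gd Gs (L delta : R) :
  admissible T eps M cup g0s g1s qs -> admissible T eps M cup g0d g1d Gd ->
  admissible T eps M cup g0s g1s Gs ->
  0 < L -> S * dot5 eps M T qs qs <= L ^+ 2 ->
  qs 0%N 0%N (eps, 0) = 2^-1 -> qs 0%N 0%N (M, 0) = 2^-1 ->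
  0 < delta -> norm5 eps M T (Gd - Gs) < delta ->
  Num.sqrt S * delta <= gap / 2 ->
  admissible T eps M cup g0d g1d (competitor qs Gd Gs (bump_weight L) delta).
Proof.
move=> [Hqs bqs lqs] [Hd bd ld] [Hs bs ls] L0 qL qe qM d0 Gn kd.
split.
- by apply: H5_comb; [exact: Hqs|exact: H5_correction].
- move=> t tT; have [q0 [dq [gq q1]] qM1] := bqs t tT.
  have [d00 [dd [gd d1]] dM1] := bd t tT; have [s0 [ds [gs s1]] sM1] := bs t tT.
  have eT : eps < T + eps by rewrite ltrDr.
  have tE : eps <= t + eps <= T + eps.
    by case/andP: tT => t0 tT; rewrite lerDr t0 lerD2r tT.
  have dE : dq = ds := deriv_on_unique eT tE gq gs.
  split.
  + by rewrite /competitor /correction {1 2 3}/comb bumpE q0 d00 s0; ring.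
  + exists dd; split => //.
    by rewrite /competitor /correction {1 2 3}/comb bump_deriv q1 d1 s1 dE; ring.
  + by rewrite /competitor /correction {1 2 3}/comb bump_deriv qM1 dM1 sM1; ring.
- by move=> x xeM; apply: competitor_ge_qlow.
Qed.

Lemma ball_admissible_convex r g0 g1 q h s : 0 <= r -> 0 <= s <= 1 ->
  ball_admissible r T eps M cup g0 g1 q -> ball_admissible r T eps M cup g0 g1 h ->
  ball_admissible r T eps M cup g0 g1 (comb (1 - s) q s h).
Proof.
move=> r0 s01 [[Hq bq lq] nq] [[Hh bh lh] nh]; split; last first.
  move: nq nh; rewrite !norm5_le// => nq nh.
  have := sob_dot_convex (measurable_Omega eps M T) (H5_jet_sqint Hq) (H5_jet_sqint Hh) s01.
  move/le_trans; apply; rewrite -!/(dot5 _ _ _ _ _).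
  case/andP: s01 => s0 s1.
  have : s * dot5 eps M T h h <= s * r ^+ 2 by rewrite ler_wpM2l.
  have : (1 - s) * dot5 eps M T q q <= (1 - s) * r ^+ 2 by rewrite ler_wpM2l// subr_ge0.
  lra.
split; first exact: H5_comb.
- move=> t tT; have [q0 [dq [gq q1]] qM1] := bq t tT.
  have [h0 [dh [gh h1]] hM1] := bh t tT.
  have eT : eps < T + eps by rewrite ltrDr.
  have tE : eps <= t + eps <= T + eps.
    by case/andP: tT => t0 tT; rewrite lerDr t0 lerD2r tT.
  have dE : dq = dh := deriv_on_unique eT tE gq gh.
  split.
  + by rewrite /comb q0 h0; ring.
  + by exists dq; split => //; rewrite /comb q1 h1 dE; ring.
  + by rewrite /comb qM1 hM1; ring.
- move=> x xeM; have := lq x xeM; have := lh x xeM; rewrite /comb => hx qx.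
  case/andP: s01 => s0 s1.
  have : s * qlow cup <= s * h 0%N 0%N (x, 0) by rewrite ler_wpM2l.
  have : (1 - s) * qlow cup <= (1 - s) * q 0%N 0%N (x, 0) by rewrite ler_wpM2l// subr_ge0.
  lra.
Qed.

End Admissible.

(** * Pointwise estimates *)

Section Pointwise.
Context (R : realType).
Implicit Types (x y a b u v k L E : R).

Lemma sqrM_le x y X Y : x ^+ 2 <= X -> y ^+ 2 <= Y -> (x * y) ^+ 2 <= X * Y.
Proof. by move=> xX yY; rewrite exprMn; apply: ler_pM; rewrite ?sqr_ge0. Qed.

Lemma sqr_le_nneg a b : 0 <= a -> a <= b -> a ^+ 2 <= b ^+ 2.
Proof. by move=> a0 ab; rewrite ler_pXn2r// nnegrE// (le_trans a0). Qed.

Lemma sqr_sum6_le (a b c d e f : R) : (a + b + c + d + e + f) ^+ 2 <=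
  6 * (a ^+ 2 + b ^+ 2 + c ^+ 2 + d ^+ 2 + e ^+ 2 + f ^+ 2).
Proof.
rewrite -subr_ge0 [X in 0 <= X](_ : _ =
  (a - b) ^+ 2 + (a - c) ^+ 2 + (a - d) ^+ 2 + (a - e) ^+ 2 + (a - f) ^+ 2 +
  (b - c) ^+ 2 + (b - d) ^+ 2 + (b - e) ^+ 2 + (b - f) ^+ 2 + (c - d) ^+ 2 +
  (c - e) ^+ 2 + (c - f) ^+ 2 + (d - e) ^+ 2 + (d - f) ^+ 2 + (e - f) ^+ 2); last by ring.
by rewrite !addr_ge0 ?sqr_ge0.
Qed.

Definition residual_const k L : R :=
  6 * (1 + k ^+ 4 + L ^+ 2 * k ^+ 6 + k ^+ 6 + 9 * (L ^+ 2 * k ^+ 8)).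

Lemma residual_const_ge0 k L : 0 <= residual_const k L.
Proof.
have e (n : nat) : 0 <= k ^+ n.*2 by rewrite -muln2 exprM sqr_ge0.
have k4 : 0 <= k ^+ 4 := e 2%N; have k6 : 0 <= k ^+ 6 := e 3%N.
have := mulr_ge0 (sqr_ge0 L) k6; have := mulr_ge0 (sqr_ge0 L) (e 4%N : 0 <= k ^+ 8).
by rewrite /residual_const; lra.
Qed.

(** With u = 1/q(x,0) at the competitor and v = 1/q(x,0) at the exact solution,
    the left-hand side is F(qs + r) - F(qs) squared: [rho] and [rho'] are r and
    r_x at (x, 0), [a] and [b] are the traces of the first x-derivative.  Every
    term contains either a derivative of r, or rho or rho' times a derivative
    of qs; u - v is of order rho. *)
Lemma Fop_pointwise (r20 r11 r01 q11 q01 u v k a b rho rho' L E : R) :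
  0 <= u <= k -> 0 <= v <= k -> v - u = u * v * rho -> a = b + rho' ->
  a ^+ 2 <= L ^+ 2 -> b ^+ 2 <= L ^+ 2 -> rho ^+ 2 <= E -> rho' ^+ 2 <= E ->
  (r20 - (q11 + r11) * u ^+ 2 / 2 + (q01 + r01) * a * u ^+ 3 / 2
   + (q11 * v ^+ 2 / 2 - q01 * b * v ^+ 3 / 2)) ^+ 2 <=
  residual_const k L * (r20 ^+ 2 + r11 ^+ 2 + r01 ^+ 2 + E * (q11 ^+ 2 + q01 ^+ 2)).
Proof.
move=> /andP[u0 uk] /andP[v0 vk] vu ab aL bL rE rE'.
have k0 := le_trans u0 uk.
have E0 : 0 <= E := le_trans (sqr_ge0 _) rE.
have uv0 : 0 <= u * v by rewrite mulr_ge0.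
have uvk : u * v <= k ^+ 2 by rewrite expr2 ler_pM.
have u2k : u ^+ 2 <= k ^+ 2 by exact: sqr_le_nneg.
have v2k : v ^+ 2 <= k ^+ 2 by exact: sqr_le_nneg.
have u3k : u ^+ 3 <= k ^+ 3 by rewrite !(exprS _ 2) ler_pM ?sqr_ge0.
have u30 : 0 <= u ^+ 3 by rewrite exprn_ge0.
have k20 := sqr_ge0 k.
set F := (X in X ^+ 2 <= _).
have -> : F = r20 + r11 * (- (u ^+ 2 / 2)) + r01 * (a * (u ^+ 3 / 2)) +
   q11 * (rho * (u * v * (u + v) / 2)) + q01 * (rho' * (u ^+ 3 / 2)) +
   q01 * (b * (rho * (- (u * v * (u ^+ 2 + u * v + v ^+ 2) / 2)))).
  have E1 : v ^+ 2 = u ^+ 2 + u * v * rho * (u + v) by rewrite -vu; ring.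
  have E2 : v ^+ 3 = u ^+ 3 + u * v * rho * (u ^+ 2 + u * v + v ^+ 2) by rewrite -vu; ring.
  by rewrite /F E2 E1 ab; ring.
apply: le_trans (sqr_sum6_le _ _ _ _ _ _) _.
have c2 : (- (u ^+ 2 / 2)) ^+ 2 <= k ^+ 4.
  rewrite sqrrN (_ : k ^+ 4 = (k ^+ 2) ^+ 2); last by rewrite -exprM.
  by apply: sqr_le_nneg; have := sqr_ge0 u; lra.
have c3 : (u ^+ 3 / 2) ^+ 2 <= k ^+ 6.
  rewrite (_ : k ^+ 6 = (k ^+ 3) ^+ 2); last by rewrite -exprM.
  by apply: sqr_le_nneg; lra.
have c4 : (u * v * (u + v) / 2) ^+ 2 <= k ^+ 6.
  rewrite (_ : k ^+ 6 = (k ^+ 2 * k) ^+ 2); last by ring.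
  have p0 : 0 <= u * v * ((u + v) / 2) by rewrite mulr_ge0//; lra.
  by rewrite -mulrA; apply: sqr_le_nneg => //; apply: ler_pM => //; lra.
have c6 : (- (u * v * (u ^+ 2 + u * v + v ^+ 2) / 2)) ^+ 2 <= 9 * k ^+ 8.
  have := sqr_ge0 u; have := sqr_ge0 v => v20 u20.
  rewrite sqrrN (_ : 9 * k ^+ 8 = (k ^+ 2 * (3 * k ^+ 2)) ^+ 2); last by ring.
  have p0 : 0 <= u * v * ((u ^+ 2 + u * v + v ^+ 2) / 2) by rewrite mulr_ge0//; lra.
  by rewrite -mulrA; apply: sqr_le_nneg => //; apply: ler_pM => //; lra.
have t2 : (r11 * (- (u ^+ 2 / 2))) ^+ 2 <= r11 ^+ 2 * k ^+ 4 by exact: sqrM_le.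
have t3 : (r01 * (a * (u ^+ 3 / 2))) ^+ 2 <= r01 ^+ 2 * (L ^+ 2 * k ^+ 6).
  by apply: sqrM_le => //; exact: sqrM_le.
have t4 : (q11 * (rho * (u * v * (u + v) / 2))) ^+ 2 <= q11 ^+ 2 * (E * k ^+ 6).
  by apply: sqrM_le => //; exact: sqrM_le.
have t5 : (q01 * (rho' * (u ^+ 3 / 2))) ^+ 2 <= q01 ^+ 2 * (E * k ^+ 6).
  by apply: sqrM_le => //; exact: sqrM_le.
have t6 : (q01 * (b * (rho * (- (u * v * (u ^+ 2 + u * v + v ^+ 2) / 2))))) ^+ 2 <=
    q01 ^+ 2 * (L ^+ 2 * (E * (9 * k ^+ 8))).
  by do !apply: sqrM_le => //.
have e (n : nat) : 0 <= k ^+ n.*2 by rewrite -muln2 exprM sqr_ge0.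
have k4 : 0 <= k ^+ 4 := e 2%N; have k6 : 0 <= k ^+ 6 := e 3%N.
have k8 : 0 <= k ^+ 8 := e 4%N.
rewrite /residual_const -[leRHS]mulrA ler_pM2l//.
have := sqr_ge0 r20; have := sqr_ge0 r11; have := sqr_ge0 r01.
have := mulr_ge0 E0 (sqr_ge0 q11); have := mulr_ge0 E0 (sqr_ge0 q01).
set s20 := r20 ^+ 2 in t2 t3 t4 t5 t6 *; set s11 := r11 ^+ 2 in t2 t3 t4 t5 t6 *.
set s01 := r01 ^+ 2 in t2 t3 t4 t5 t6 *.
rewrite (mulrC E) in t4 t5 *.
have -> : E * (q11 ^+ 2 + q01 ^+ 2) = E * q11 ^+ 2 + E * q01 ^+ 2 by ring.
have e4 : q11 ^+ 2 * (k ^+ 6 * E) = E * q11 ^+ 2 * k ^+ 6 by ring.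
have e5 : q01 ^+ 2 * (k ^+ 6 * E) = E * q01 ^+ 2 * k ^+ 6 by ring.
have e6 : q01 ^+ 2 * (L ^+ 2 * (E * (9 * k ^+ 8))) =
  E * q01 ^+ 2 * (9 * (L ^+ 2 * k ^+ 8)) by ring.
rewrite e4 in t4; rewrite e5 in t5; rewrite e6 in t6.
set w11 := E * q11 ^+ 2 in t4 *; set w01 := E * q01 ^+ 2 in t5 t6 *.
have l6 : 0 <= L ^+ 2 * k ^+ 6 by rewrite mulr_ge0 ?sqr_ge0.
have l8 : 0 <= 9 * (L ^+ 2 * k ^+ 8) by exact: mulr_ge0 (ler0n _ _) (mulr_ge0 (sqr_ge0 L) k8).
move: k4 k6 l6 l8 t2 t3 t4 t5 t6.
set K4 := k ^+ 4; set K6 := k ^+ 6; set L6 := L ^+ 2 * K6; set L8 := 9 * _.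
move=> k4 k6 l6 l8 t2 t3 t4 t5 t6 w010 w110 s010 s110 s200.
apply: (@le_trans _ _ (s20 + s11 * K4 + s01 * L6 + w11 * K6 + w01 * K6 + w01 * L8)).
  by rewrite !lerD.
rewrite -subr_ge0 [X in 0 <= X](_ : _ =
  s20 * (K4 + L6 + K6 + L8) + s11 * (1 + L6 + K6 + L8) + s01 * (1 + K4 + K6 + L8) +
  w11 * (1 + K4 + L6 + L8) + w01 * (1 + K4 + L6)); last by ring.
have P (s t : R) : 0 <= s -> 0 <= t -> 0 <= s * t by exact: mulr_ge0.
by do !(apply: addr_ge0); apply: P => //; do ?(apply: addr_ge0 => //).
Qed.

Definition coef_const k L : R := k ^+ 10 + 4 * (L ^+ 2 * k ^+ 12).

(** The map q |-> q^-4 / 16 and its derivative are Lipschitz where q^-1 <= k. *)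
Lemma coef_pointwise (u v k a b rho L : R) :
  0 <= u <= k -> 0 <= v <= k -> u - v = - (u * v * rho) ->
  b ^+ 2 <= L ^+ 2 ->
  (16^-1 * (u ^+ 4 - v ^+ 4)) ^+ 2 + (4^-1 * (a * u ^+ 5 - b * v ^+ 5)) ^+ 2 <=
  coef_const k L * ((a - b) ^+ 2 + rho ^+ 2) + k ^+ 10 * rho ^+ 2.
Proof.
move=> /andP[u0 uk] /andP[v0 vk] uv bL.
have k0 := le_trans u0 uk.
have pw (n m : nat) : 0 <= u ^+ n * v ^+ m <= k ^+ (n + m).
  by rewrite mulr_ge0 ?exprn_ge0//= exprD ler_pM ?exprn_ge0// lerXn2r ?nnegrE.
have c1 : (16^-1 * (u ^+ 4 - v ^+ 4)) ^+ 2 <= k ^+ 10 * rho ^+ 2.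
  have -> : 16^-1 * (u ^+ 4 - v ^+ 4) =
      - ((u ^+ 4 * v ^+ 1 + u ^+ 3 * v ^+ 2 + u ^+ 2 * v ^+ 3 + u ^+ 1 * v ^+ 4) / 16) * rho.
    have -> : u ^+ 4 - v ^+ 4 = (u - v) * (u ^+ 3 + u ^+ 2 * v + u * v ^+ 2 + v ^+ 3) by ring.
    by rewrite uv; ring.
  apply: sqrM_le => //; rewrite sqrrN (_ : k ^+ 10 = (k ^+ 5) ^+ 2); last by rewrite -exprM.
  have /andP[? ?] := pw 4%N 1%N; have /andP[? ?] := pw 3%N 2%N.
  have /andP[? ?] := pw 2%N 3%N; have /andP[? ?] := pw 1%N 4%N.
  by apply: sqr_le_nneg; lra.
have c2 : (4^-1 * (a * u ^+ 5 - b * v ^+ 5)) ^+ 2 <=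
    k ^+ 10 * (a - b) ^+ 2 + 4 * (L ^+ 2 * k ^+ 12) * rho ^+ 2.
  have -> : 4^-1 * (a * u ^+ 5 - b * v ^+ 5) = (u ^+ 5 / 4) * (a - b) +
      b * (- ((u ^+ 5 * v ^+ 1 + u ^+ 4 * v ^+ 2 + u ^+ 3 * v ^+ 3 + u ^+ 2 * v ^+ 4 +
               u ^+ 1 * v ^+ 5) / 4) * rho).
    have H5 : u ^+ 5 - v ^+ 5 = - (u * v * rho) *
      (u ^+ 4 + u ^+ 3 * v + u ^+ 2 * v ^+ 2 + u * v ^+ 3 + v ^+ 4) by rewrite -uv; ring.
    have -> : a * u ^+ 5 - b * v ^+ 5 = u ^+ 5 * (a - b) + b * (u ^+ 5 - v ^+ 5) by ring.
    by rewrite H5; ring.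
  have d1 : (u ^+ 5 / 4 * (a - b)) ^+ 2 <= k ^+ 10 / 4 * (a - b) ^+ 2.
    apply: sqrM_le => //; rewrite (_ : k ^+ 10 / 4 = (k ^+ 5 / 2) ^+ 2); last by field.
    have /andP[] := pw 5%N 0%N; rewrite expr0 mulr1 => ? ?.
    by apply: sqr_le_nneg; lra.
  have d2 : (b * (- ((u ^+ 5 * v ^+ 1 + u ^+ 4 * v ^+ 2 + u ^+ 3 * v ^+ 3 + u ^+ 2 * v ^+ 4 +
               u ^+ 1 * v ^+ 5) / 4) * rho)) ^+ 2 <= L ^+ 2 * ((25 / 16 * k ^+ 12) * rho ^+ 2).
    apply: sqrM_le => //; apply: sqrM_le => //.
    rewrite sqrrN (_ : _ * k ^+ 12 = (5 / 4 * k ^+ 6) ^+ 2); last by field.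
    have /andP[? ?] := pw 5%N 1%N; have /andP[? ?] := pw 4%N 2%N.
    have /andP[? ?] := pw 3%N 3%N; have /andP[? ?] := pw 2%N 4%N.
    have /andP[? ?] := pw 1%N 5%N.
    by apply: sqr_le_nneg; lra.
  set X := u ^+ 5 / 4 * (a - b) in d1 *; set Y := b * _ in d2 *.
  apply: (@le_trans _ _ (2 * X ^+ 2 + 2 * Y ^+ 2)).
    by have := sqr_ge0 (X - Y); lra.
  have r0 := mulr_ge0 (mulr_ge0 (sqr_ge0 L) (exprn_ge0 12 k0)) (sqr_ge0 rho).
  have a0 := mulr_ge0 (exprn_ge0 10 k0) (sqr_ge0 (a - b)).
  lra.
have r0 := mulr_ge0 (mulr_ge0 (sqr_ge0 L) (exprn_ge0 12 k0)) (sqr_ge0 (a - b)).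
have r1 := mulr_ge0 (exprn_ge0 10 k0) (sqr_ge0 rho).
by rewrite /coef_const; lra.
Qed.

End Pointwise.

(** * Weighted integrals, the functional and the H^1 norms on t = 0 *)

Lemma invf_mulX (F : fieldType) (a x : F) n :
  (a * x ^+ n)^-1 = a^-1 * x^-1 ^+ n.
Proof. by rewrite invfM exprVn. Qed.

Lemma sob_dot1E (R : realType) (U : set (plane R)) (q : jet R) :
  sob_dot 1 U q q = \int[leb2 R]_(p in U) (q 0%N 0%N p ^+ 2) +
    \int[leb2 R]_(p in U) (q 0%N 1%N p ^+ 2) +
    \int[leb2 R]_(p in U) (q 1%N 0%N p ^+ 2).
Proof.
rewrite /sob_dot !big_ord_recl !big_ord0 /= addr0.
rewrite [X in X + _](_ : _ = \int[leb2 R]_(p in U) (q 0%N 0%N p ^+ 2) +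
    \int[leb2 R]_(p in U) (q 0%N 1%N p ^+ 2)); last first.
  by rewrite big_mkcond !big_ord_recl big_ord0 /= addr0.
by congr (_ + _); rewrite big_mkcond !big_ord_recl big_ord0 /= !addr0.
Qed.

Section Integrals.
Context (R : realType).
Variables (eps M T : R).
Hypotheses (eps0 : 0 < eps) (epsM : eps < M) (T0 : 0 < T).
Notation Om := (Omega eps M T).
Notation cOm := (cOmega eps M T).
Notation S := (sobolev_const eps M T).
Notation mu := (@lebesgue_measure R).
Implicit Types (q h r : jet R).

Lemma trace_within q i : H5 eps M T q -> (i <= 3)%N ->
  {within `[eps, M], continuous (fun x => q i 0%N (x, 0))}.
Proof.
move=> Hq i3; apply: (@cOmega_line_x _ _ _ T); last by rewrite lexx ltW.
by apply: (H5_cont Hq); rewrite addn0.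
Qed.

(** Square of the H^1(eps, M) norm of q(.,0). *)
Definition trace_sqr q : R :=
  \int[mu]_(x in `]eps, M[) (q 1%N 0%N (x, 0) ^+ 2 + q 0%N 0%N (x, 0) ^+ 2).

Lemma trace_integrable q : H5 eps M T q -> mu.-integrable `]eps, M[
  (EFin \o (fun x => q 1%N 0%N (x, 0) ^+ 2 + q 0%N 0%N (x, 0) ^+ 2)).
Proof.
by move=> Hq; apply: within_itv_integrable_oo; apply: within_sqr_sum; exact: trace_within.
Qed.

Lemma trace_sqr_comb_le a q b h : H5 eps M T q -> H5 eps M T h ->
  trace_sqr (comb a q b h) <= 2 * a ^+ 2 * trace_sqr q + 2 * b ^+ 2 * trace_sqr h.
Proof.
move=> Hq Hh; rewrite /trace_sqr.
have m := @measurable_itvR R `]eps, M[.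
have iq := trace_integrable Hq; have ih := trace_integrable Hh.
rewrite -(RintegralZl _ m iq) -(RintegralZl _ m ih).
have iq' := integrableZl m (2 * a ^+ 2) iq; have ih' := integrableZl m (2 * b ^+ 2) ih.
rewrite -(RintegralD m iq' ih'); apply: le_Rintegral => //.
- exact: trace_integrable (H5_comb a b Hq Hh).
- by have := integrableD m iq' ih'.
- move=> x _; rewrite /comb.
  set x1 := q _ _ _; set x2 := h _ _ _; set x3 := q _ _ _; set x4 := h _ _ _.
  by have := sqr_ge0 (a * x1 - b * x2); have := sqr_ge0 (a * x3 - b * x4); lra.
Qed.

Lemma trace_sqr_le q : H5 eps M T q ->
  trace_sqr q <= (M - eps) * (2 * (S * dot5 eps M T q q)).
Proof.
move=> Hq; set B := 2 * _.
have -> : (M - eps) * B = \int[mu]_(x in `]eps, M[) B.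
  rewrite Rintegral_cst/=; last exact: measurable_itvR.
  by rewrite mulrC lebesgue_measure_itv/= lte_fin epsM.
apply: le_Rintegral => //.
- exact: trace_integrable.
- by apply: within_itv_integrable_oo; exact: cst_continuous.
- move=> x; rewrite /= in_itv/= => /andP[ex xM].
  have cx : cOm (x, 0) by split; rewrite /= ?lexx !ltW.
  have := H5_sup_bound epsM T0 Hq (leqnn 1) cx; have := H5_sup_bound epsM T0 Hq (leq0n 1) cx.
  by rewrite /B; lra.
Qed.

Section Weight.
Variables (lam alpha : R).
Hypotheses (lam0 : 0 <= lam) (alpha0 : 0 <= alpha).

Definition weight (p : R * R) : R := expR (- (2 * lam * (p.1 + alpha * p.2))).

Lemma measurable_weight : measurable_fun (Om : set (plane R)) (weight : plane R -> R).
Proof.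
apply: measurable_funTS; apply: continuous_measurable2 => p.
apply: continuous_comp; last exact: continuous_expR.
apply: cvgN; apply: cvgM; first exact: cvg_cst.
apply: cvgD; first exact: cvg_fst.
by apply: cvgM; [exact: cvg_cst|exact: cvg_snd].
Qed.

Lemma weight_le1 p : Om p -> 0 <= weight p <= 1.
Proof.
case: p => x t [/= /andP[ex xM] /andP[t0 tT]]; rewrite expR_ge0/= -expR0 ler_expR.
rewrite oppr_le0 mulr_ge0 ?mulr_ge0// addr_ge0 ?mulr_ge0//; last exact: ltW.
by rewrite ltW// (lt_trans eps0).
Qed.

Lemma weight_integrable (g : plane R -> R) : (forall p, 0 <= g p) ->
  (leb2 R).-integrable Om (EFin \o g) ->
  (leb2 R).-integrable Om (EFin \o (fun p => weight p * g p)).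
Proof.
move=> g0 gi; have mO := measurable_Omega eps M T.
apply: (le_integrable mO _ _ gi).
  apply/measurable_EFinP/measurable_funM; first exact: measurable_weight.
  by apply/measurable_EFinP; case/integrableP: gi.
move=> p Op /=; have /andP[w0 w1] := weight_le1 Op.
by rewrite lee_fin !ger0_norm ?mulr_ge0// ler_piMl.
Qed.

(** On the smaller rectangle x + alpha t <= M + alpha T1. *)
Lemma weighted_lower q T1 : H5 eps M T q -> 0 < T1 -> T1 < T ->
  expR (- (2 * lam * (M + alpha * T1))) * sob_dot 1 (Omega eps M T1) q q <=
  \int[leb2 R]_(p in Om) (expR (- (2 * lam * (p.1 + alpha * p.2))) *
    (q 1%N 0%N p ^+ 2 + q 0%N 1%N p ^+ 2 + q 0%N 0%N p ^+ 2)).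
Proof.
move=> Hq T10 T1T; have mO := measurable_Omega eps M T.
have mO1 := measurable_Omega eps M T1.
have sub : Omega eps M T1 `<=` Om.
  by move=> p [p1 /andP[t0 tT1]]; split => //; rewrite t0 (lt_trans tT1).
have s i j (ij : (i + j <= 5)%N) := sqint_sqr (H5_sqint Hq ij).
have s1 i j (ij : (i + j <= 5)%N) := sqint_sqr (sqintS mO mO1 sub (H5_sqint Hq ij)).
have i1 := integrableD mO1
  (integrableD mO1 (s1 1%N 0%N isT) (s1 0%N 1%N isT)) (s1 0%N 0%N isT).
have i0 := integrableD mO (integrableD mO (s 1%N 0%N isT) (s 0%N 1%N isT)) (s 0%N 0%N isT).
set G := fun p : plane R => q 1%N 0%N p ^+ 2 + q 0%N 1%N p ^+ 2 + q 0%N 0%N p ^+ 2.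
have -> : sob_dot 1 (Omega eps M T1) q q = \int[leb2 R]_(p in Omega eps M T1) G p.
  have i01 := integrableD mO1 (s1 1%N 0%N isT) (s1 0%N 1%N isT).
  rewrite /G (RintegralD mO1 i01 (s1 0%N 0%N isT)).
  rewrite (RintegralD mO1 (s1 1%N 0%N isT) (s1 0%N 1%N isT)) sob_dot1E; ring.
have G0 p : 0 <= G p by rewrite !addr_ge0 ?sqr_ge0.
rewrite -(RintegralZl _ mO1 i1).
apply: le_subset_Rintegral => //.
- exact: (integrableZl mO1 _ i1).
- exact: (weight_integrable G0 i0).
- by move=> p _; exact: mulr_ge0 (expR_ge0 _) (G0 p).
- case=> x t [/= /andP[ex xM] /andP[t0 tT1]].
  apply: ler_wpM2r; first exact: G0.
  rewrite ler_expR lerN2 ler_wpM2l ?mulr_ge0// lerD ?ler_wpM2l//; exact: ltW.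
Qed.

Lemma weighted_trace_lower q : H5 eps M T q ->
  expR (- (2 * lam * M)) * trace_sqr q <=
  \int[mu]_(x in `]eps, M[)
     (expR (- (2 * lam * x)) * (q 1%N 0%N (x, 0) ^+ 2 + q 0%N 0%N (x, 0) ^+ 2)).
Proof.
move=> Hq; have m := @measurable_itvR R `]eps, M[.
have iq := trace_integrable Hq.
rewrite /trace_sqr -(RintegralZl _ m iq); apply: le_Rintegral => //.
- by have := integrableZl m (expR (- (2 * lam * M))) iq.
- apply: within_itv_integrable_oo => x; apply: cvgM.
    apply: (continuous_subspaceT _) => y.
    apply: continuous_comp; last exact: continuous_expR.
    by apply: cvgN; apply: cvgM; [exact: cvg_cst|exact: cvg_id].
  by apply: within_sqr_sum; exact: trace_within.
- move=> x; rewrite /= in_itv/= => /andP[ex xM].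
  apply: ler_wpM2r; first by rewrite addr_ge0 ?sqr_ge0.
  by rewrite ler_expR lerN2 ler_wpM2l ?mulr_ge0// ltW.
Qed.

End Weight.

Section Residual.
Variables (lo L : R).
Hypothesis lo0 : 0 < lo.

Lemma inv_trace_within q : H5 eps M T q ->
  (forall x, eps <= x <= M -> lo <= q 0%N 0%N (x, 0)) ->
  {within `[eps, M], continuous (fun x => (q 0%N 0%N (x, 0))^-1)}.
Proof.
move=> Hq qlo; apply/subspace_continuousP => x xeM; apply: cvgV.
  by rewrite gt_eqF// (lt_le_trans lo0)// qlo//; move: xeM; rewrite /= in_itv.
by have /subspace_continuousP := trace_within Hq (leq0n 3); exact.
Qed.

Lemma measurable_fst_within (g : R -> R) : {within `[eps, M], continuous g} ->
  measurable_fun (Om : set (plane R)) (fun p : plane R => g p.1).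
Proof.
move=> cg; apply: (@measurable_comp _ _ _ _ _ _ (`[eps, M] : set (measurableTypeR R))).
- exact: measurable_itvR.
- by move=> _ [p [/andP[ep pM] _] <-] /=; rewrite in_itv/= !ltW.
- by apply: subspace_continuous_measurable_fun => //; exact: measurable_itvR.
- by apply: measurable_funTS; exact: measurable_fst.
Qed.

Lemma measurable_Fop q : H5 eps M T q ->
  (forall x, eps <= x <= M -> lo <= q 0%N 0%N (x, 0)) ->
  measurable_fun (Om : set (plane R)) (Fop q : plane R -> R).
Proof.
move=> Hq qlo.
have mi := measurable_fst_within (inv_trace_within Hq qlo).
have mqx := measurable_fst_within (@trace_within q 1 Hq isT).
have mq i j (ij : (i + j <= 5)%N) := sqint_measurable (H5_sqint Hq ij).
have -> : (Fop q : plane R -> R) = (fun p => q 2%N 0%N p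
   - q 1%N 1%N p * (2^-1 * (q 0%N 0%N (p.1, 0))^-1 ^+ 2)
   + q 0%N 1%N p * (q 1%N 0%N (p.1, 0) * (2^-1 * (q 0%N 0%N (p.1, 0))^-1 ^+ 3))).
  apply/funext => p; rewrite /Fop !invf_mulX; ring.
apply: measurable_funD; first apply: measurable_funB.
- exact: mq.
- apply: measurable_funM; first exact: mq.
  by apply: measurable_funM => //; exact: measurable_funX.
- apply: measurable_funM; first exact: mq.
  apply: measurable_funM; first exact: mqx.
  by apply: measurable_funM => //; exact: measurable_funX.
Qed.

Lemma Fop_sqr_le qs r p :
  H5 eps M T qs -> H5 eps M T r ->
  (forall x, eps <= x <= M -> lo <= qs 0%N 0%N (x, 0)) ->
  (forall x, eps <= x <= M -> lo <= comb 1 qs 1 r 0%N 0%N (x, 0)) ->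
  S * dot5 eps M T qs qs <= L ^+ 2 ->
  S * dot5 eps M T (comb 1 qs 1 r) (comb 1 qs 1 r) <= L ^+ 2 ->
  Om p -> Fop qs p = 0 ->
  Fop (comb 1 qs 1 r) p ^+ 2 <= residual_const lo^-1 L *
    (r 2%N 0%N p ^+ 2 + r 1%N 1%N p ^+ 2 + r 0%N 1%N p ^+ 2 +
     S * dot5 eps M T r r * (qs 1%N 1%N p ^+ 2 + qs 0%N 1%N p ^+ 2)).
Proof.
move=> Hq Hr qlo clo qL cL Op F0.
have xeM : eps <= p.1 <= M by case: Op => /andP[e m] _; rewrite !ltW.
have cx : cOm (p.1, 0) by split => //=; rewrite lexx ltW.
have Hc := H5_comb 1 1 Hq Hr.
have := le_trans (H5_sup_bound epsM T0 Hq (leqnn 1) cx) qL => bL.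
have := le_trans (H5_sup_bound epsM T0 Hc (leqnn 1) cx) cL => aL.
have r0 := H5_sup_bound epsM T0 Hr (leq0n 1) cx.
have r1 := H5_sup_bound epsM T0 Hr (leqnn 1) cx.
have b0 := qlo _ xeM; have a0 := clo _ xeM.
set q' := comb 1 qs 1 r in a0 aL *.
have E i j z : q' i j z = qs i j z + r i j z by rewrite /q' /comb !mul1r.
have bp := lt_le_trans lo0 b0; have ap := lt_le_trans lo0 a0.
have inv x : lo <= x -> 0 <= x^-1 <= lo^-1.
  by move=> lx; have x0 := lt_le_trans lo0 lx; rewrite invr_ge0 lef_pV2 ?posrE ?lx// ltW.
have := @Fop_pointwise R (r 2%N 0%N p) (r 1%N 1%N p) (r 0%N 1%N p)
  (qs 1%N 1%N p) (qs 0%N 1%N p) (q' 0%N 0%N (p.1, 0))^-1 (qs 0%N 0%N (p.1, 0))^-1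
  lo^-1 (q' 1%N 0%N (p.1, 0)) (qs 1%N 0%N (p.1, 0)) (r 0%N 0%N (p.1, 0))
  (r 1%N 0%N (p.1, 0)) L _ (inv _ a0) (inv _ b0) _ (E _ _ _) aL bL r0 r1.
have -> : Fop q' p = r 2%N 0%N p -
  (qs 1%N 1%N p + r 1%N 1%N p) * (q' 0%N 0%N (p.1, 0))^-1 ^+ 2 / 2 +
  (qs 0%N 1%N p + r 0%N 1%N p) * q' 1%N 0%N (p.1, 0) * (q' 0%N 0%N (p.1, 0))^-1 ^+ 3 / 2 +
  (qs 1%N 1%N p * (qs 0%N 0%N (p.1, 0))^-1 ^+ 2 / 2 -
   qs 0%N 1%N p * qs 1%N 0%N (p.1, 0) * (qs 0%N 0%N (p.1, 0))^-1 ^+ 3 / 2).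
  have {F0} : qs 2%N 0%N p = qs 1%N 1%N p * (qs 0%N 0%N (p.1, 0))^-1 ^+ 2 / 2 -
     qs 0%N 1%N p * qs 1%N 0%N (p.1, 0) * (qs 0%N 0%N (p.1, 0))^-1 ^+ 3 / 2.
    by move: F0; rewrite /Fop !invf_mulX; lra.
  rewrite /Fop (E 2%N 0%N p) (E 1%N 1%N p) (E 0%N 1%N p) => ->.
  by rewrite !invf_mulX; ring.
apply.
have -> : r 0%N 0%N (p.1, 0) = q' 0%N 0%N (p.1, 0) - qs 0%N 0%N (p.1, 0) by rewrite E; ring.
by field; rewrite !gt_eqF.
Qed.

(** [Fop_sqr_le] integrated; the factor 3 counts r_xx, r_xt, r_t. *)
Lemma Jfun_le lam alpha beta qs r : 0 <= lam -> 0 <= alpha ->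
  H5 eps M T qs -> H5 eps M T r ->
  (forall x, eps <= x <= M -> lo <= qs 0%N 0%N (x, 0)) ->
  (forall x, eps <= x <= M -> lo <= comb 1 qs 1 r 0%N 0%N (x, 0)) ->
  S * dot5 eps M T qs qs <= L ^+ 2 ->
  S * dot5 eps M T (comb 1 qs 1 r) (comb 1 qs 1 r) <= L ^+ 2 ->
  (forall p, Om p -> Fop qs p = 0) ->
  Jfun T eps M lam alpha beta (comb 1 qs 1 r) <=
  residual_const lo^-1 L * ((3 + 2 * L ^+ 2) * dot5 eps M T r r) +
  beta * dot5 eps M T (comb 1 qs 1 r) (comb 1 qs 1 r).
Proof.
move=> lam0 alpha0 Hq Hr qlo clo qL cL F0; have mO := measurable_Omega eps M T.
rewrite /Jfun; have -> : norm5 eps M T (comb 1 qs 1 r) ^+ 2 =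
  dot5 eps M T (comb 1 qs 1 r) (comb 1 qs 1 r) by exact: sob_norm_sqr.
rewrite lerD2r.
have s i j (ij : (i + j <= 5)%N) := sqint_sqr (H5_sqint Hr ij).
have sq i j (ij : (i + j <= 5)%N) := sqint_sqr (H5_sqint Hq ij).
pose E := S * dot5 eps M T r r.
have E0 : 0 <= E by rewrite mulr_ge0 ?sob_dot_ge0// ltW ?sobolev_const_gt0.
have i1 := integrableD mO (s 2%N 0%N isT) (s 1%N 1%N isT).
have i2 := integrableD mO i1 (s 0%N 1%N isT).
have i3 := integrableD mO (sq 1%N 1%N isT) (sq 0%N 1%N isT).
have i4 := integrableZl mO E i3.
have i5 := integrableD mO i2 i4.
have i6 := integrableZl mO (residual_const lo^-1 L) i5.
pose G (p : plane R) := residual_const lo^-1 L *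
    (r 2%N 0%N p ^+ 2 + r 1%N 1%N p ^+ 2 + r 0%N 1%N p ^+ 2 +
     E * (qs 1%N 1%N p ^+ 2 + qs 0%N 1%N p ^+ 2)).
have iG : (leb2 R).-integrable Om (EFin \o G) by exact: i6.
have G0 p : 0 <= G p.
  rewrite mulr_ge0 ?residual_const_ge0// addr_ge0//; first by rewrite !addr_ge0 ?sqr_ge0.
  by rewrite mulr_ge0// addr_ge0 ?sqr_ge0.
have wF p : Om p -> weight lam alpha p * Fop (comb 1 qs 1 r) p ^+ 2 <= G p.
  move=> Op; have /andP[w0 w1] := weight_le1 lam0 alpha0 Op.
  apply: le_trans (Fop_sqr_le Hq Hr qlo clo qL cL Op (F0 _ Op)).
  by rewrite ler_piMl ?sqr_ge0.
apply: (@le_trans _ _ (\int[leb2 R]_(p in Om) G p)).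
  apply: (le_Rintegral mO _ iG wF).
  apply: (le_integrable mO _ _ iG).
    apply/measurable_EFinP/measurable_funM; first exact: measurable_weight.
    by apply: measurable_funX; exact: measurable_Fop (H5_comb 1 1 Hq Hr) clo.
  move=> p Op /=; have /andP[w0 _] := weight_le1 lam0 alpha0 Op.
  rewrite lee_fin (ger0_norm (G0 p)) ger0_norm; first exact: wF.
  by rewrite mulr_ge0 ?sqr_ge0.
rewrite /G (RintegralZl _ mO i5) ler_wpM2l ?residual_const_ge0//.
rewrite (RintegralD mO i2 i4) (RintegralZl _ mO i3).
rewrite (RintegralD mO i1 (s 0%N 1%N isT)).
rewrite (RintegralD mO (s 2%N 0%N isT) (s 1%N 1%N isT)).
rewrite (RintegralD mO (sq 1%N 1%N isT) (sq 0%N 1%N isT)).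
have Lr i j (ij : (i + j <= 5)%N) := @le_sob_dot R 5 Om r i j ij.
have Lq i j (ij : (i + j <= 5)%N) := @le_sob_dot R 5 Om qs i j ij.
have l1 := Lr 2%N 0%N isT; have l2 := Lr 1%N 1%N isT; have l3 := Lr 0%N 1%N isT.
have l4 : E * (\int[leb2 R]_(x in Om) qs 1%N 1%N x ^+ 2 +
    \int[leb2 R]_(x in Om) qs 0%N 1%N x ^+ 2) <= 2 * L ^+ 2 * dot5 eps M T r r.
  apply: (@le_trans _ _ (E * (2 * dot5 eps M T qs qs))).
    rewrite ler_wpM2l//; have := Lq 1%N 1%N isT; have := Lq 0%N 1%N isT.
    by rewrite /dot5; clear -eps0 epsM T0 lo0; lra.
  have : dot5 eps M T r r * (S * dot5 eps M T qs qs) <= dot5 eps M T r r * L ^+ 2.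
    by rewrite ler_wpM2l// sob_dot_ge0.
  by rewrite /E; clear -eps0 epsM T0 lo0; lra.
by move: l1 l2 l3 l4; rewrite -!/(dot5 _ _ _ _ _); clear -eps0 epsM T0 lo0; lra.
Qed.

Lemma H1_norm_trace q h : H5 eps M T q -> H5 eps M T h ->
  H1_norm eps M (fun x => q 0%N 0%N (x, 0) - h 0%N 0%N (x, 0)) ^+ 2 =
  trace_sqr (comb 1 q (-1) h).
Proof.
move=> Hq Hh; rewrite /H1_norm sqr_sqrtr; last first.
  by apply: Rintegral_ge0 => x _; rewrite addr_ge0 ?sqr_ge0.
apply: eq_Rintegral => x; rewrite inE /= in_itv/= => xeM.
have dq := is_derive_trace0 T0 Hq xeM; have dh := is_derive_trace0 T0 Hh xeM.
rewrite derive1E derive_val /comb; ring.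
Qed.

Lemma is_derive_coef_of q x : H5 eps M T q ->
  (forall x, eps <= x <= M -> lo <= q 0%N 0%N (x, 0)) -> eps < x < M ->
  is_derive x 1 (coef_of q)
    (- (4^-1 * (q 1%N 0%N (x, 0) * (q 0%N 0%N (x, 0))^-1 ^+ 5))).
Proof.
move=> Hq qlo xeM; have dq := is_derive_trace0 T0 Hq xeM.
have q0 : 0 < q 0%N 0%N (x, 0).
  by rewrite (lt_le_trans lo0)// qlo//; case/andP: xeM => ? ?; rewrite !ltW.
have dq4 : is_derive x 1 (fun y : R => 16 * q 0%N 0%N (y, 0) ^+ 4)
    (64 * q 0%N 0%N (x, 0) ^+ 3 * q 1%N 0%N (x, 0)).
  by apply: is_derive_eq; rewrite /GRing.scale/=; ring.
have n0 : 16 * q 0%N 0%N (x, 0) ^+ 4 != 0 by rewrite gt_eqF// mulr_gt0// exprn_gt0.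
apply: DeriveDef; first by apply: derivableV.
rewrite /coef_of deriveV// derive_val /GRing.scale/=.
by field; rewrite gt_eqF.
Qed.

Lemma H1_norm_coef q h : H5 eps M T q -> H5 eps M T h ->
  (forall x, eps <= x <= M -> lo <= q 0%N 0%N (x, 0)) ->
  (forall x, eps <= x <= M -> lo <= h 0%N 0%N (x, 0)) ->
  S * dot5 eps M T h h <= L ^+ 2 ->
  H1_norm eps M (fun x => coef_of q x - coef_of h x) ^+ 2 <=
  (coef_const lo^-1 L + lo^-1 ^+ 10) * trace_sqr (comb 1 q (-1) h).
Proof.
move=> Hq Hh qlo hlo hL; rewrite /H1_norm sqr_sqrtr; last first.
  by apply: Rintegral_ge0 => x _; rewrite addr_ge0 ?sqr_ge0.
have cq := inv_trace_within Hq qlo; have ch := inv_trace_within Hh hlo.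
have cq1 := @trace_within q 1 Hq isT; have ch1 := @trace_within h 1 Hh isT.
have m := @measurable_itvR R `]eps, M[.
pose u x := (q 0%N 0%N (x, 0))^-1; pose v x := (h 0%N 0%N (x, 0))^-1.
pose f x := 16^-1 * (u x ^+ 4 - v x ^+ 4).
pose g x := 4^-1 * (q 1%N 0%N (x, 0) * u x ^+ 5 - h 1%N 0%N (x, 0) * v x ^+ 5).
have -> : \int[mu]_(x in `]eps, M[) ((coef_of q x - coef_of h x) ^+ 2 +
    derive1 (fun x => coef_of q x - coef_of h x) x ^+ 2) =
  \int[mu]_(x in `]eps, M[) (f x ^+ 2 + g x ^+ 2).
  apply: eq_Rintegral => x; rewrite inE /= in_itv/= => xeM.
  have dq := is_derive_coef_of Hq qlo xeM; have dh := is_derive_coef_of Hh hlo xeM.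
  have -> : derive1 (fun x => coef_of q x - coef_of h x) x ^+ 2 = g x ^+ 2.
    by rewrite derive1E derive_val /g /u /v; ring.
  by congr (_ + _); rewrite /coef_of /f /u /v !invf_mulX; ring.
have it := trace_integrable (H5_comb 1 (-1) Hq Hh).
rewrite /trace_sqr -(RintegralZl _ m it); apply: le_Rintegral => //.
- apply: within_itv_integrable_oo; apply: within_sqr_sum => x.
    apply: cvgM; first exact: cvg_cst.
    apply: cvgB; first by do 3 (apply: cvgM; [exact: cq|]); exact: cq.
    by do 3 (apply: cvgM; [exact: ch|]); exact: ch.
  apply: cvgM; first exact: cvg_cst.
  apply: cvgB; apply: cvgM; [exact: cq1| |exact: ch1|].
    by do 4 (apply: cvgM; [exact: cq|]); exact: cq.
  by do 4 (apply: cvgM; [exact: ch|]); exact: ch.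
- by have := integrableZl m (coef_const lo^-1 L + lo^-1 ^+ 10) it.
- move=> x; rewrite /= in_itv/= => /andP[ex xM].
  have xeM : eps <= x <= M by rewrite !ltW.
  have cx : cOm (x, 0) by split => //=; rewrite lexx ltW.
  have bL := le_trans (H5_sup_bound epsM T0 Hh (leqnn 1) cx) hL.
  have b0 := hlo _ xeM; have a0 := qlo _ xeM.
  have inv z : lo <= z -> 0 <= z^-1 <= lo^-1.
    by move=> lx; have x0 := lt_le_trans lo0 lx; rewrite invr_ge0 lef_pV2 ?posrE ?lx// ltW.
  have bp := lt_le_trans lo0 b0; have ap := lt_le_trans lo0 a0.
  have uv : u x - v x = - (u x * v x * (q 0%N 0%N (x, 0) - h 0%N 0%N (x, 0))).
    by rewrite /u /v; field; rewrite !gt_eqF.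
  have := coef_pointwise (q 1%N 0%N (x, 0)) (inv _ a0) (inv _ b0) uv bL.
  move=> /le_trans; apply; rewrite /comb !mul1r !mulN1r.
  have k0 : 0 <= lo^-1 by rewrite invr_ge0 ltW.
  have := mulr_ge0 (exprn_ge0 10 k0) (sqr_ge0 (q 1%N 0%N (x, 0) - h 1%N 0%N (x, 0))).
  by lra.
Qed.

End Residual.
End Integrals.

(** * Stability of the minimizer *)

(** Otherwise a short step in the direction [h] would decrease J: the linear term
    dominates the error of the Frechet derivative. *)
Lemma minimizer_gradient_ge0 (R : realType) (T eps M : R) (A : set (jet R))
    (J : jet R -> R) (q d h : jet R) :
  minimizer A J q -> frechet_gradient T eps M A J q d -> H5 eps M T h ->
  (forall s, 0 <= s <= 1 -> A (q + comb s h 0 h)) ->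
  0 <= dot5 eps M T d h.
Proof.
move=> [Aq qmin] [[Hd _] grad] Hh Aqh.
have sd := H5_jet_sqint Hd; have sh := H5_jet_sqint Hh; have mO := measurable_Omega eps M T.
rewrite leNgt; apply/negP => neg.
pose n := norm5 eps M T h; have n0 : 0 <= n by exact: sqrtr_ge0.
have n10 : 0 < 2 * (n + 1) by rewrite mulr_gt0// ltr_pwDr.
(* e makes the error at most half of the linear term. *)
pose e := - dot5 eps M T d h / (2 * (n + 1)).
have e0 : 0 < e by rewrite divr_gt0// oppr_gt0.
have [r r0 gr] := grad e e0.
pose s := Num.min 1 (r / (2 * (n + 1))).
have s0 : 0 < s by rewrite lt_min ltr01 divr_gt0.
have s1 : s <= 1 by rewrite /s ge_min lexx.
have sr : s * (2 * (n + 1)) <= r by rewrite -ler_pdivlMr// /s ge_min lexx orbT.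
have ns : norm5 eps M T (comb s h 0 h) <= s * n.
  rewrite norm5_le; last by rewrite mulr_ge0// ltW.
  rewrite /dot5 (sob_dot_comb2 mO _ _ sh sh).
  have -> : n = sob_norm 5 (Omega eps M T) h by [].
  by rewrite exprMn sob_norm_sqr; lra.
have sn := mulr_ge0 (ltW s0) n0.
have Ash : A (q + comb s h 0 h) by apply: Aqh; rewrite ltW.
have nr : norm5 eps M T (comb s h 0 h) < r by apply: (le_lt_trans ns); lra.
have := gr _ Ash nr.
have -> : dot5 eps M T d (comb s h 0 h) = s * dot5 eps M T d h.
  by rewrite /dot5 (sob_dot_combr mO _ _ sh sh sd) mul0r addr0.
move=> /(le_trans (ler_norm _)) Jle; have Jge := qmin _ Ash.
have en : e * norm5 eps M T (comb s h 0 h) <= e * (s * n) by rewrite ler_wpM2l// ltW.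
have E : e * (2 * (n + 1)) = - dot5 eps M T d h by rewrite /e divfK// gt_eqF.
have es : 0 < s * e by rewrite mulr_gt0.
have : s * (e * (2 * (n + 1))) = - (s * dot5 eps M T d h) by rewrite E; ring.
have := mulr_gt0 es n10; have := mulr_ge0 (ltW es) n0.
lra.
Qed.

Section Exponents.
Context (R : realType).
Variables (alphaT delta lam : R).
Hypotheses (aT0 : 0 < alphaT) (d0 : 0 < delta)
  (lamE : lam = ln (delta `^ (- (2 / alphaT)))).

Lemma powR_expR_ln (x : R) : delta `^ x = expR (x * ln delta).
Proof. by rewrite /powR gt_eqF. Qed.

(** lam is chosen precisely for this. *)
Lemma delta_sqrE : delta ^+ 2 = expR (- (lam * alphaT)).
Proof.
rewrite -[in LHS](lnK d0) expr2 -expRD lamE ln_powR; congr expR.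
by field; rewrite gt_eqF.
Qed.

Lemma weight_deltaE (m : R) :
  delta ^+ 2 = expR (- (2 * lam * m)) * (delta `^ ((alphaT - 2 * m) / alphaT)) ^+ 2.
Proof.
rewrite powR_expR_ln delta_sqrE expr2 -!expRD lamE ln_powR; congr expR.
by field; rewrite gt_eqF.
Qed.

Lemma delta_lt1 : 0 < lam -> delta < 1.
Proof.
move=> l0; rewrite -(ltr_pXn2r (n := 2))// ?nnegrE ?ltW//.
by rewrite expr1n delta_sqrE expR_lt1 oppr_lt0 mulr_gt0.
Qed.

End Exponents.

Lemma le_of_sqr (R : rcfType) (X Y K : R) : 0 <= Y -> 0 <= K ->
  X ^+ 2 <= K * Y ^+ 2 -> X <= Num.sqrt K * Y.
Proof.
move=> Y0 K0; rewrite -[in K * _](sqr_sqrtr K0) -exprMn => XY.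
have Z0 : 0 <= Num.sqrt K * Y by rewrite mulr_ge0// sqrtr_ge0.
have [X0|X0] := leP 0 X; last exact: le_trans (ltW X0) Z0.
by move: XY; rewrite ler_pXn2r.
Qed.

Section Stability.
Context (R : realType).
Variables (rad T eps M cup alpha : R).
Hypotheses (eps0 : 0 < eps) (epsM : eps < M) (T0 : 0 < T) (rad0 : 0 < rad)
  (cup1 : 1 < cup) (alpha0 : 0 < alpha).
Notation Om := (Omega eps M T).
Notation S := (sobolev_const eps M T).
Notation dot q := (dot5 eps M T q q).
Notation lo := (qlow cup).

(** Bound for the traces of q and q_x at t = 0 in the ball of radius [rad]. *)
Definition trace_bound : R := Num.sqrt S * rad.
Notation A := (bump_weight eps M T cup trace_bound).
Notation B := (correction_const eps M T A).

(** J(qhat) <= cost_const * delta^2. *)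
Definition cost_const : R :=
  residual_const lo^-1 trace_bound * ((3 + 2 * trace_bound ^+ 2) * B) + 2 * rad ^+ 2.

(** Below this level the competitor satisfies the constraint and lies in the
    ball. *)
Definition small_noise : R := Num.min (gap cup / (2 * Num.sqrt S)) (rad / (2 * (1 + B))).

Let S0 : 0 < S. Proof. exact: sobolev_const_gt0. Qed.
Let B0 : 0 < B. Proof. exact: correction_const_gt0. Qed.

Lemma trace_bound_gt0 : 0 < trace_bound.
Proof. by rewrite mulr_gt0// sqrtr_gt0 S0. Qed.

Lemma trace_bound_sqr : trace_bound ^+ 2 = S * rad ^+ 2.
Proof. by rewrite exprMn sqr_sqrtr// ltW// S0. Qed.

Lemma cost_const_gt0 : 0 < cost_const.
Proof.
rewrite ltr_wpDl//; last by rewrite mulr_gt0// exprn_gt0.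
rewrite mulr_ge0 ?residual_const_ge0// mulr_ge0 ?(ltW B0)//.
by rewrite addr_ge0// mulr_ge0// sqr_ge0.
Qed.

Lemma small_noise_gt0 : 0 < small_noise.
Proof.
rewrite lt_min !divr_gt0 ?gap_gt0 ?mulr_gt0 ?sqrtr_gt0 ?S0//.
by rewrite ltr_pwDl// ltW// B0.
Qed.

Lemma small_noise_gap delta : 0 < delta -> delta <= small_noise ->
  Num.sqrt S * delta <= gap cup / 2.
Proof.
move=> d0; rewrite le_min => /andP[+ _].
have s0 : 0 < Num.sqrt S by rewrite sqrtr_gt0 S0.
rewrite ler_pdivlMr ?mulr_gt0// => h; lra.
Qed.

Lemma small_noise_ball delta : 0 < delta -> delta <= small_noise ->
  B * delta ^+ 2 <= rad ^+ 2 / 4.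
Proof.
move=> d0; rewrite le_min => /andP[_].
have b0 := B0; rewrite ler_pdivlMr; last by rewrite mulr_gt0// ltr_pwDl// ltW.
move=> h; have h' : delta * (1 + B) <= rad / 2 by lra.
have : (delta * (1 + B)) ^+ 2 <= (rad / 2) ^+ 2.
  by apply: sqr_le_nneg => //; rewrite mulr_ge0 ?(ltW d0)// addr_ge0 ?(ltW b0).
have d2 := sqr_ge0 delta; have := mulr_ge0 (sqr_ge0 B) d2; have := mulr_ge0 (ltW b0) d2.
have -> : (delta * (1 + B)) ^+ 2 =
  delta ^+ 2 + 2 * (B * delta ^+ 2) + B ^+ 2 * delta ^+ 2 by ring.
have -> : (rad / 2) ^+ 2 = rad ^+ 2 / 4 by field.
by move: (B * delta ^+ 2) (B ^+ 2 * delta ^+ 2) => x y; lra.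
Qed.

Lemma sob_dot1_le (T1 : R) q : H5 eps M T q -> 0 < T1 -> T1 < T ->
  sob_dot 1 (Omega eps M T1) q q <= 3 * dot q.
Proof.
move=> Hq T10 T1T; have mO := measurable_Omega eps M T.
have mO1 := measurable_Omega eps M T1.
have sub : Omega eps M T1 `<=` Om.
  by move=> p [p1 /andP[t0 tT1]]; split => //; rewrite t0 (lt_trans tT1).
have l i j (ij : (i + j <= 5)%N) :
    \int[leb2 R]_(p in Omega eps M T1) (q i j p ^+ 2) <= dot q.
  apply: le_trans (@le_sob_dot R 5 Om q i j ij).
  apply: (le_subset_Rintegral mO1 mO sub).
  - exact: sqint_sqr (sqintS mO mO1 sub (H5_sqint Hq ij)).
  - exact: sqint_sqr (H5_sqint Hq ij).
  - by move=> p _; exact: sqr_ge0.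
  - by [].
have := l 0%N 0%N isT; have := l 0%N 1%N isT; have := l 1%N 0%N isT.
by rewrite sob_dot1E; lra.
Qed.

Section OneDelta.
Variables (g0s g1s g0d g1d : R -> R) (qs Gs Gd qmin : jet R).
Variables (delta lam beta C T1 : R).
Hypotheses (aqs : admissible T eps M cup g0s g1s qs)
  (aGd : admissible T eps M cup g0d g1d Gd)
  (aGs : admissible T eps M cup g0s g1s Gs)
  (F0 : forall p, Om p -> Fop qs p = 0)
  (nqs : norm5 eps M T qs < rad / 3)
  (nG : norm5 eps M T (Gd - Gs) < delta)
  (qe : qs 0%N 0%N (eps, 0) = 2^-1) (qM : qs 0%N 0%N (M, 0) = 2^-1)
  (d0 : 0 < delta) (lam0 : 0 < lam)
  (lamE : lam = ln (delta `^ (- (2 / (alpha * T)))))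
  (betaE : beta = 2 * expR (- (lam * alpha * T)))
  (C0 : 0 < C) (T10 : 0 < T1) (T1T : T1 < T).
Let AA := ball_admissible rad T eps M cup g0d g1d.
Let J := Jfun T eps M lam alpha beta.
Hypotheses
  (convJ : forall q, AA q -> exists2 d, frechet_gradient T eps M AA J q d &
      forall h, AA (q + h) -> convexity_lower_bound T eps M lam alpha beta C h <=
        J (q + h) - J q - dot5 eps M T d h)
  (minq : minimizer AA J qmin).

Let r := correction eps M Gd Gs A delta.
Let qhat := comb 1 qs 1 r.
Let h := comb 1 qhat (-1) qmin.

Let Hqs : H5 eps M T qs. Proof. by case: aqs. Qed.
Let Hr : H5 eps M T r.
Proof. by apply: H5_correction => //; [case: aGd|case: aGs]. Qed.
Let Hmin : H5 eps M T qmin. Proof. by case: minq => -[[]]. Qed.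
Let Hhat : H5 eps M T qhat. Proof. exact: H5_comb. Qed.
Let Hh : H5 eps M T h. Proof. exact: H5_comb. Qed.

Let dot_qs : dot qs <= rad ^+ 2 / 9.
Proof.
have := ltW nqs; rewrite norm5_le; last by rewrite divr_ge0// ltW.
by have -> : (rad / 3) ^+ 2 = rad ^+ 2 / 9 by field.
Qed.

Let dot_r : dot r <= B * delta ^+ 2.
Proof. by apply: dot5_correction => //; [case: aGd|case: aGs]. Qed.

Let dot_qmin : dot qmin <= rad ^+ 2.
Proof. by case: minq => -[_ +] _; rewrite norm5_le//; exact: ltW. Qed.

Let aT0 : 0 < alpha * T. Proof. by rewrite mulr_gt0. Qed.

Let betaE' : beta = 2 * delta ^+ 2.
Proof. by rewrite betaE (delta_sqrE aT0 d0 lamE) mulrA. Qed.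

Let diffE : comb 1 qs (-1) qmin = comb 1 h (-1) r.
Proof.
apply/funext => i; apply/funext => j; apply/funext => p.
by rewrite /h /qhat /comb; ring.
Qed.

(** The convexity inequality at the minimizer in the direction of the
    competitor. *)
Lemma competitor_cost : delta <= small_noise ->
  C * (expR (- (2 * lam * (M + alpha * T1))) * sob_dot 1 (Omega eps M T1) h h)
    <= cost_const * delta ^+ 2 /\
  C * (expR (- (2 * lam * M)) * trace_sqr eps M h) <= cost_const * delta ^+ 2.
Proof.
move=> dd1.
have gd := small_noise_gap d0 dd1; have bd := small_noise_ball d0 dd1.
have r2 : 0 < rad ^+ 2 by rewrite exprn_gt0.
have SqL : S * dot qs <= trace_bound ^+ 2.
  by rewrite trace_bound_sqr ler_wpM2l ?(ltW S0)//; have := dot_qs; lra.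
have ahat : admissible T eps M cup g0d g1d qhat.
  exact: (competitor_admissible epsM T0 cup1 aqs aGd aGs trace_bound_gt0 SqL qe qM
    d0 nG gd).
have dhat : dot qhat <= rad ^+ 2.
  have := sob_dot_comb_le (measurable_Omega eps M T) 1 1 (H5_jet_sqint Hqs) (H5_jet_sqint Hr).
  rewrite -!/(dot5 _ _ _ _ _) -/qhat; have := dot_qs; have := dot_r.
  by move: (B * _) bd => x bd h1 h2 h3; lra.
have Ahat : AA qhat by split => //; rewrite norm5_le//; exact: ltW.
have Amin : AA qmin by case: minq.
have [d gradd conv] := convJ Amin.
have hE : qmin + h = qhat.
  apply/funext => i; apply/funext => j; apply/funext => p.
  by rewrite -[LHS]/(qmin i j p + h i j p) /h /comb; ring.
have gr0 : 0 <= dot5 eps M T d h.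
  apply: (minimizer_gradient_ge0 minq gradd Hh) => s s01.
  have -> : qmin + comb s h 0 h = comb (1 - s) qmin s qhat.
    apply/funext => i; apply/funext => j; apply/funext => p.
    rewrite -[LHS]/(qmin i j p + comb s h 0 h i j p) /h /comb; ring.
  by apply: ball_admissible_convex => //; exact: ltW.
have := conv h; rewrite hE => /(_ Ahat) lb.
have Jmin0 : 0 <= J qmin.
  rewrite /J /Jfun addr_ge0//.
    by apply: Rintegral_ge0 => p _; rewrite mulr_ge0 ?expR_ge0 ?sqr_ge0.
  by rewrite mulr_ge0 ?sqr_ge0// betaE' mulr_ge0 ?sqr_ge0.
have qlo : forall x, eps <= x <= M -> lo <= qs 0%N 0%N (x, 0) by case: aqs.
have hlo : forall x, eps <= x <= M -> lo <= qhat 0%N 0%N (x, 0) by case: ahat.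
have ShL : S * dot qhat <= trace_bound ^+ 2 by rewrite trace_bound_sqr ler_wpM2l ?(ltW S0).
have Jhat : J qhat <= cost_const * delta ^+ 2.
  apply: le_trans (Jfun_le eps0 epsM T0 (qlow_gt0 cup1) beta (ltW lam0)
    (ltW alpha0) Hqs Hr qlo hlo SqL ShL F0) _.
  rewrite -/qhat betaE'.
  have k0 : 0 <= residual_const lo^-1 trace_bound * (3 + 2 * trace_bound ^+ 2).
    by rewrite mulr_ge0 ?residual_const_ge0// addr_ge0// mulr_ge0// sqr_ge0.
  have := ler_wpM2l k0 dot_r.
  have := ler_wpM2l (mulr_ge0 (ler0n R 2) (sqr_ge0 delta)) dhat.
  by rewrite /cost_const; lra.
have w1 := weighted_lower eps0 (ltW lam0) (ltW alpha0) Hh T10 T1T.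
have w2 := weighted_trace_lower T0 (ltW lam0) Hh.
move: lb; rewrite /convexity_lower_bound.
set I1 := Rintegral _ _ _ in w1 *; set I2 := Rintegral _ _ _ in w2 *.
have I10 : 0 <= I1.
  apply: Rintegral_ge0 => p _; rewrite mulr_ge0 ?expR_ge0//.
  by rewrite !addr_ge0 ?sqr_ge0.
have I20 : 0 <= I2.
  apply: Rintegral_ge0 => p _; rewrite mulr_ge0 ?expR_ge0//.
  by rewrite !addr_ge0 ?sqr_ge0.
have b0 : 0 <= beta / 2 * norm5 eps M T h ^+ 2.
  by rewrite mulr_ge0 ?sqr_ge0// divr_ge0// betaE' mulr_ge0 ?sqr_ge0.
have c1 := ler_wpM2l (ltW C0) w1; have c2 := ler_wpM2l (ltW C0) w2.
have c10 := mulr_ge0 (ltW C0) I10; have c20 := mulr_ge0 (ltW C0) I20.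
by split; lra.
Qed.

(** The last summand takes care of noise levels above [small_noise]. *)
Definition stability_const : R :=
  2 * cost_const / C + 6 * B + 4 * ((M - eps) * S * B) +
  (12 * rad ^+ 2 + 8 * ((M - eps) * S * rad ^+ 2)) / small_noise ^+ 2.

Lemma stability_const_gt0 : 0 < stability_const.
Proof.
have ks := cost_const_gt0; have b0 := B0; have s0 := S0.
have me : 0 < M - eps by rewrite subr_gt0.
have p1 : 0 < 2 * cost_const / C by apply: divr_gt0 => //; exact: mulr_gt0.
have p2 : 0 < 6 * B by exact: mulr_gt0.
have ms : 0 < (M - eps) * S by exact: mulr_gt0.
have p3 : 0 < 4 * ((M - eps) * S * B) by apply: mulr_gt0 => //; exact: mulr_gt0.
have r2 : 0 <= (M - eps) * S * rad ^+ 2 := mulr_ge0 (ltW ms) (sqr_ge0 rad).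
have p4 : 0 <= (12 * rad ^+ 2 + 8 * ((M - eps) * S * rad ^+ 2)) / small_noise ^+ 2.
  apply: divr_ge0; last exact: sqr_ge0.
  by have := sqr_ge0 rad; lra.
by apply: ltr_pwDl p4; rewrite !addr_gt0.
Qed.

(** Below [small_noise] use [competitor_cost] and qs - qmin = h - r.  Above it,
    bound qs - qmin by the diameter of the ball; since delta < 1, the powers of
    delta on the right are at least [small_noise]. *)
Lemma stability_sqr (rho1 rho2 : R) :
  rho1 = (alpha * T - 2 * (M + alpha * T1)) / (alpha * T) ->
  rho2 = (alpha * T - 2 * M) / (alpha * T) ->
  rho1 <= 1 -> rho2 <= 1 ->
  sob_dot 1 (Omega eps M T1) (comb 1 qs (-1) qmin) (comb 1 qs (-1) qmin) <=
    stability_const * (delta `^ rho1) ^+ 2 /\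
  trace_sqr eps M (comb 1 qs (-1) qmin) <= stability_const * (delta `^ rho2) ^+ 2.
Proof.
move=> rho1E rho2E rho11 rho21.
have d1 := delta_lt1 aT0 d0 lamE lam0.
have dp rho : rho <= 1 -> delta ^+ 2 <= (delta `^ rho) ^+ 2.
  by move=> rho_le1; apply: sqr_le_nneg; [exact: ltW|apply: ger1_powR => //; rewrite d0 ltW].
have ks := cost_const_gt0; have b0 := B0; have s0 := S0.
have me : 0 < M - eps by rewrite subr_gt0.
have r2 := sqr_ge0 rad; have d10 := small_noise_gt0.
have p1 := sqr_ge0 (delta `^ rho1); have p2 := sqr_ge0 (delta `^ rho2).
set P1 := (delta `^ rho1) ^+ 2 in p1 *; set P2 := (delta `^ rho2) ^+ 2 in p2 *.
pose X1 := 2 * cost_const / C; pose X2 := 6 * B; pose X3 := 4 * ((M - eps) * S * B).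
pose X4 := 12 * rad ^+ 2 / small_noise ^+ 2.
pose X5 := 8 * ((M - eps) * S * rad ^+ 2) / small_noise ^+ 2.
have ms : 0 <= (M - eps) * S by exact: mulr_ge0 (ltW me) (ltW s0).
have y0 : 0 <= 8 * ((M - eps) * S * rad ^+ 2) := mulr_ge0 (ler0n _ _) (mulr_ge0 ms r2).
have XE : stability_const = X1 + X2 + X3 + X4 + X5.
  by rewrite /stability_const /X1 /X2 /X3 /X4 /X5; ring.
have x1 : 0 <= X1 by rewrite /X1 divr_ge0 ?mulr_ge0 ?ltW.
have x2 : 0 <= X2 by rewrite /X2 mulr_ge0 ?ltW.
have x3 : 0 <= X3 := mulr_ge0 (ler0n _ _) (mulr_ge0 ms (ltW b0)).
have x4 : 0 <= X4 := divr_ge0 (mulr_ge0 (ler0n _ _) r2) (sqr_ge0 _).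
have x5 : 0 <= X5 := divr_ge0 y0 (sqr_ge0 _).
have K1 := mulr_ge0 x1 p1; have K2 := mulr_ge0 x2 p1; have K3 := mulr_ge0 x3 p1.
have K4 := mulr_ge0 x4 p1; have K5 := mulr_ge0 x5 p1.
have K1' := mulr_ge0 x1 p2; have K2' := mulr_ge0 x2 p2; have K3' := mulr_ge0 x3 p2.
have K4' := mulr_ge0 x4 p2; have K5' := mulr_ge0 x5 p2.
have [small|large] := leP delta small_noise.
  have [c1 c2] := competitor_cost small.
  move: c1 c2; rewrite {1}(weight_deltaE aT0 d0 lamE (M + alpha * T1)) -rho1E -/P1.
  rewrite {1}(weight_deltaE aT0 d0 lamE M) -rho2E -/P2.
  set w1 := expR _; set w2 := expR _.
  have w10 : 0 < w1 by exact: expR_gt0.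
  have w20 : 0 < w2 by exact: expR_gt0.
  set D := sob_dot _ _ _ _; set t := trace_sqr _ _ _ => c1 c2.
  have e1 : 2 * D <= X1 * P1.
    have : C * D <= cost_const * P1 by rewrite -(ler_pM2l w10); lra.
    rewrite /X1 mulrAC ler_pdivlMr//; lra.
  have e2 : 2 * t <= X1 * P2.
    have : C * t <= cost_const * P2 by rewrite -(ler_pM2l w20); lra.
    rewrite /X1 mulrAC ler_pdivlMr//; lra.
  have mO1 := measurable_Omega eps M T1.
  have sub5 q : H5 eps M T q -> jet_sqint 1 (Omega eps M T1) q.
    move=> Hq i j ij; apply: (sqintS (measurable_Omega eps M T) mO1).
      by move=> p [p1' /andP[t0 tT1]]; split => //; rewrite t0 (lt_trans tT1).
    by apply: H5_sqint => //; rewrite (leq_trans ij).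
  rewrite diffE; split.
    apply: le_trans (sob_dot_comb_le mO1 1 (-1) (sub5 _ Hh) (sub5 _ Hr)) _.
    have := sob_dot1_le Hr T10 T1T; have := dot_r.
    have := ler_wpM2l (ltW b0) (dp _ rho11); rewrite -/P1 -/D.
    by rewrite XE; move: K3 K4 K5; rewrite /X2; lra.
  apply: le_trans (trace_sqr_comb_le T0 1 (-1) Hh Hr) _.
  have := trace_sqr_le epsM T0 Hr; have := ler_wpM2l ms dot_r.
  have := ler_wpM2l (mulr_ge0 ms (ltW b0)) (dp _ rho21); rewrite -/P2 -/t.
  by rewrite XE; move: K2' K4' K5'; rewrite /X3; lra.
have ddiff : dot (comb 1 qs (-1) qmin) <= 4 * rad ^+ 2.
  have := sob_dot_comb_le (measurable_Omega eps M T) 1 (-1)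
    (H5_jet_sqint Hqs) (H5_jet_sqint Hmin).
  rewrite -!/(dot5 _ _ _ _ _); have := dot_qs; have := dot_qmin; lra.
have Hdiff := H5_comb 1 (-1) Hqs Hmin.
have d12 : small_noise ^+ 2 <= delta ^+ 2 by apply: sqr_le_nneg; exact: ltW.
have d120 : 0 < small_noise ^+ 2 by rewrite exprn_gt0.
have lg rho Y : 0 <= Y -> rho <= 1 -> Y <= Y / small_noise ^+ 2 * (delta `^ rho) ^+ 2.
  move=> Y0 rho_le1; rewrite mulrAC ler_pdivlMr// ler_wpM2l//.
  exact: le_trans d12 (dp _ rho_le1).
split.
  have := sob_dot1_le Hdiff T10 T1T.
  have := lg rho1 (12 * rad ^+ 2) (mulr_ge0 (ler0n R 12) r2) rho11; rewrite -/P1.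
  by rewrite XE; move: K1 K2 K3 K5; rewrite -/X4; lra.
have := trace_sqr_le epsM T0 Hdiff; have := ler_wpM2l ms ddiff.
have := lg rho2 _ y0 rho21; rewrite -/P2.
by rewrite XE; move: K1' K2' K3' K4'; rewrite -/X5; lra.
Qed.

End OneDelta.
End Stability.

Theorem theorem5p2 (R : realType) (rad T eps M clow cup alpha lam1 : R)
    (heps : 0 < eps < 1) (hM : 1 < M) (hT : 0 < T) (hrad : 0 < rad)
    (hclow : 0 < clow) (hclowup : clow < cup) (hcup : 1 < cup)
    (halpha : 0 < alpha < 2 * Num.sqrt cup)
    (hlam1 : convexity_threshold rad T eps cup alpha M lam1)
    (halphaT : 2 * M < alpha * T) :
  exists2 C : R, 0 < C &
    forall (T0 delta0 : R),
      0 < T0 < T -> 2 * M + 2 * alpha * T0 < alpha * T ->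
      0 < delta0 -> delta0 < 2 * rad / 3 ->
      lam1 <= ln (delta0 `^ (- (2 / (alpha * T)))) ->
    forall (delta : R), 0 < delta < delta0 ->
    forall (g0s g1s g0d g1d c : R -> R) (qs Gs Gd qmin : jet R)
           (lam beta rho1 rho2 : R),
      (exists p : jet R, ball_admissible (rad / 3) T eps M cup g0d g1d p) ->
      (forall p : R * R, Omega eps M T p -> Fop qs p = 0) ->
      admissible T eps M cup g0s g1s qs ->
      norm5 eps M T qs < rad / 3 ->
      admissible T eps M cup g0d g1d Gd ->
      admissible T eps M cup g0s g1s Gs ->
      norm5 eps M T (Gd - Gs) < delta ->
      coefficient eps M clow cup c ->
      (forall x : R, eps <= x <= M -> c x = coef_of qs x) ->
      lam1 <= lam ->
      lam = ln (delta `^ (- (2 / (alpha * T)))) ->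
      beta = 2 * expR (- (lam * alpha * T)) ->
      minimizer (ball_admissible rad T eps M cup g0d g1d)
        (Jfun T eps M lam alpha beta) qmin ->
      rho1 = (alpha * T - 2 * (M + alpha * T0)) / (alpha * T) ->
      rho2 = (alpha * T - 2 * M) / (alpha * T) ->
      [/\ 0 < rho1 < 1 /\ 0 < rho2 < 1,
          sob_norm 1 (Omega eps M T0) (qs - qmin) <= C * delta `^ rho1,
          H1_norm eps M (fun x => qs 0%N 0%N (x, 0) - qmin 0%N 0%N (x, 0))
            <= C * delta `^ rho2
        & H1_norm eps M (fun x => coef_of qs x - coef_of qmin x)
            <= C * delta `^ rho2].
Proof.
have [lam11 [C C0 thr]] := hlam1.
have /andP[eps0 eps1] := heps; have /andP[alpha0 _] := halpha.
have epsM : eps < M := lt_trans eps1 hM.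
have lo0 := qlow_gt0 hcup; have L0 := trace_bound_gt0 epsM hT hrad.
pose K := stability_const rad T eps M cup C.
have K0 : 0 < K by exact: stability_const_gt0.
pose Kc := coef_const (qlow cup)^-1 (trace_bound rad T eps M) + (qlow cup)^-1 ^+ 10.
have k0 : 0 <= (qlow cup)^-1 by rewrite invr_ge0 ltW.
have Kc0 : 0 <= Kc.
  by rewrite !addr_ge0 ?exprn_ge0// mulr_ge0// mulr_ge0 ?sqr_ge0// exprn_ge0.
have KK0 : 0 < K * (1 + Kc) by rewrite mulr_gt0// ltr_pwDl.
exists (Num.sqrt (K * (1 + Kc))); first by rewrite sqrtr_gt0.
move=> T1 delta0 /andP[T10 T1T] aT1 _ _ _ delta /andP[d0 _].
move=> g0s g1s g0d g1d c qs Gs Gd qmin lam beta rho1 rho2 _ F0 aqs nqs aGd aGs nG.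
move=> coefc cE lam1l lamE betaE minq rho1E rho2E.
have aT0 : 0 < alpha * T by rewrite mulr_gt0.
have aT10 : 0 < alpha * T1 by rewrite mulr_gt0.
have M0 : 0 < M := lt_trans ltr01 hM.
have rho1P : 0 < rho1 < 1.
  by rewrite rho1E divr_gt0 ?subr_gt0//=; [rewrite ltr_pdivrMr// mul1r|]; lra.
have rho2P : 0 < rho2 < 1.
  by rewrite rho2E divr_gt0 ?subr_gt0//= ltr_pdivrMr// mul1r; lra.
have lam0 : 0 < lam by lra.
have beta1 : 2 * expR (- (lam * alpha * T)) <= beta < 1.
  rewrite betaE lexx/= expRN ltr_pdivrMr ?expR_gt0// mul1r.
  (* alpha * T > 2 * M > 2 and lam >= 1 *)
  have y2 : 2 < lam * alpha * T.
    have : 1 * (alpha * T) <= lam * (alpha * T) by rewrite ler_wpM2r ?(ltW aT0)//; lra.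
    by rewrite mul1r mulrA; lra.
  by have := expR_ge1Dx (lam * alpha * T); move: y2; clear; lra.
have [c1 cM] := coefficient_boundary coefc.
have [_ _ lqs] := aqs.
have epsin : eps <= eps <= M by rewrite lexx ltW.
have Min : eps <= M <= M by rewrite lexx ltW.
have qe : qs 0%N 0%N (eps, 0) = 2^-1.
  by apply: coef_of_eq1; [exact: lt_le_trans lo0 (lqs _ epsin)|rewrite -cE].
have qM : qs 0%N 0%N (M, 0) = 2^-1.
  by apply: coef_of_eq1; [exact: lt_le_trans lo0 (lqs _ Min)|rewrite -cE].
have [convJ _] := thr g0d g1d lam beta lam1l beta1.
have /andP[_ r1] := rho1P; have /andP[_ r2] := rho2P.
have [D1 D2] := stability_sqr eps0 epsM hT hrad hcup alpha0 aqs aGd aGs F0 nqs nG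
  qe qM d0 lam0 lamE betaE C0 T10 T1T convJ minq rho1E rho2E (ltW r1) (ltW r2).
have [Hqs _ _] := aqs; have [[[Hmin _ lmin] nmin] _] := minq.
have KKc : K <= K * (1 + Kc) by rewrite ler_pMr// lerDl.
have p10 := powR_ge0 delta rho1; have p20 := powR_ge0 delta rho2.
split => //.
- apply: le_of_sqr => //; first exact: ltW.
  rewrite sob_norm_sqr comb_sub; apply: le_trans D1 _.
  by apply: ler_wpM2r; rewrite ?sqr_ge0.
- apply: le_of_sqr => //; first exact: ltW.
  rewrite (H1_norm_trace hT Hqs Hmin); apply: le_trans D2 _.
  by apply: ler_wpM2r; rewrite ?sqr_ge0.
- apply: le_of_sqr => //; first exact: ltW.
  have SL : sobolev_const eps M T * dot5 eps M T qmin qmin <= trace_bound rad T eps M ^+ 2.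
    rewrite (trace_bound_sqr rad epsM hT) ler_wpM2l ?(ltW (sobolev_const_gt0 epsM hT))//.
    by rewrite -norm5_le//; exact: ltW.
  apply: le_trans (H1_norm_coef epsM hT lo0 Hqs Hmin lqs lmin SL) _.
  rewrite -/Kc; have := ler_wpM2l Kc0 D2; rewrite -/K.
  have := mulr_ge0 (ltW K0) (sqr_ge0 (delta `^ rho2)); clear; lra.
Qed.
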